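(* Let $(R,\mathfrak m)$ be a Noetherian local ring, let $n\geq 1$ be an integer, and let $M_1,\ldots,M_n$ be finitely generated $R$-modules. Then $M=M_1\oplus\cdots\oplus M_n$ is sequentially $1$-Cohen-Macaulay if and only if $M_i$ is sequentially $1$-Cohen-Macaulay for all $i\leq n$.
   Context: Let $(R,\mathfrak m)$ be a Noetherian local ring and let $N$ be a finitely generated $R$-module. Let $H^i_{\mathfrak m}(N)$ denote the $i$-th local cohomology module of $N$ with respect to $\mathfrak m$, and set $\mathfrak a_i(N)=\operatorname{Ann}_R H^i_{\mathfrak m}(N)$. With $d=\dim_R(N)$, set $\mathfrak a(N)=\mathfrak a_0(N)\,\mathfrak a_1(N)\cdots\mathfrak a_{d-1}(N)$ (an empty product is $R$). The zero module has negative dimension (e.g. $-\infty$). The module $N$ is called $1$-Cohen-Macaulay if $\dim(R/\mathfrak a(N))\leq 1$. The dimension filtration of $N$ is the (unique) filtration $H^0_{\mathfrak m}(N)=D_t\subset\cdots\subset D_1\subset D_0=N$ by submodules such that $D_{i+1}$ is the largest submodule of $N$ of dimension less than $\dim_R(D_i)$ for all $i\leq t-1$. The module $N$ is called sequentially $1$-Cohen-Macaulay if each quotient $D_i/D_{i+1}$ ($0\leq i\leq t-1$) of its dimension filtration is $1$-Cohen-Macaulay. *)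

(* Defs.v *)
From HB Require Import structures.
From mathcomp Require Import all_boot all_order all_algebra.
From mathcomp Require Import generic_quotient ring_quotient.
From mathcomp Require Import boolp classical_sets constructive_ereal.

Set Implicit Arguments.
Unset Strict Implicit.
Unset Printing Implicit Defensive.

Import Order.TTheory GRing.Theory Num.Theory.

Local Open Scope classical_set_scope.
Local Open Scope ring_scope.
Local Open Scope quotient_scope.

(* Submodules of V are the inhabitants of [submodClosed V]; [submod S] is the
   submodule S regarded as a module. *)
Record submod (R : comNzRingType) (V : lmodType R) (S : submodClosed V) :=
  Submod { submod_val : V; _ : submod_val \in S }.

Section SubmodTheory.
Variables (R : comNzRingType) (V : lmodType R) (S : submodClosed V).

HB.instance Definition _ := [isSub of submod S for @submod_val R V S].
HB.instance Definition _ := [Choice of submod S by <:].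
HB.instance Definition _ := [SubChoice_isSubLmodule of submod S by <:].

End SubmodTheory.

Section Submodules.
Variables (R : comNzRingType).

Section Trace.
Variables (V : lmodType R) (A B : submodClosed V).

Definition sub_trace : {pred submod A} := fun x => val x \in B.

Fact sub_trace_closed : subsemimod_closed sub_trace.
Proof.
split; first split.
- by rewrite /sub_trace unfold_in raddf0 rpred0.
- by move=> x y Bx By; rewrite unfold_in /sub_trace raddfD rpredD.
- by move=> a x Bx; rewrite unfold_in /sub_trace linearZ rpredZ.
Qed.
HB.instance Definition _ :=
  GRing.isSubmodClosed.Build R (submod A) sub_trace sub_trace_closed.

(* A / B, when B is contained in A (in general, A / (A :&: B)) *)
Definition subquot : Type := Quotient.quot sub_trace.

HB.instance Definition _ := Choice.on subquot.
HB.instance Definition _ := GRing.Zmodule.on subquot.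

Definition subquot_scale (a : R) (x : subquot) : subquot :=
  \pi_(Quotient.quot sub_trace) (a *: repr x).

Let pi_scale a (x : submod A) :
  subquot_scale a (\pi_(Quotient.quot sub_trace) x) =
  \pi_(Quotient.quot sub_trace) (a *: x).
Proof.
apply/eqP; rewrite /subquot_scale -Quotient.idealrBE -scalerBr rpredZ //.
by rewrite Quotient.idealrBE reprK.
Qed.

Let subquot_scaleA a b x :
  subquot_scale a (subquot_scale b x) = subquot_scale (a * b) x.
Proof.
by elim/(@quotW _ (Quotient.quot sub_trace)): x => x; rewrite !pi_scale scalerA.
Qed.

Let subquot_scale1 : left_id 1 subquot_scale.
Proof.
by elim/(@quotW _ (Quotient.quot sub_trace)) => x; rewrite pi_scale scale1r.
Qed.

Let subquot_scaleDr : right_distributive subquot_scale +%R.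
Proof.
move=> a; elim/(@quotW _ (Quotient.quot sub_trace)) => x.
elim/(@quotW _ (Quotient.quot sub_trace)) => y.
by rewrite -[_ + _]Quotient.pi_add !pi_scale scalerDr Quotient.pi_add.
Qed.

Let subquot_scaleDl x : {morph subquot_scale^~ x : a b / a + b}.
Proof.
move=> a b; elim/(@quotW _ (Quotient.quot sub_trace)): x => x.
by rewrite !pi_scale scalerDl Quotient.pi_add.
Qed.

HB.instance Definition _ := GRing.Zmodule_isLmodule.Build R subquot
  subquot_scaleA subquot_scale1 subquot_scaleDr subquot_scaleDl.

End Trace.

Definition zero_sub (V : lmodType R) : {pred V} := fun x => x == 0.

Fact zero_sub_closed (V : lmodType R) : subsemimod_closed (@zero_sub V).
Proof.
split; first split.
- exact: eqxx.
- by move=> x y /eqP-> /eqP->; apply/eqP; rewrite addr0.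
- by move=> a x /eqP->; apply/eqP; rewrite scaler0.
Qed.
HB.instance Definition _ (V : lmodType R) :=
  GRing.isSubmodClosed.Build R V (@zero_sub V) (@zero_sub_closed V).

Definition im_sub (U V : lmodType R) (f : {linear U -> V})
    (S : submodClosed U) : {pred V} :=
  fun y => `[< exists2 x, x \in S & f x = y >].

Fact im_sub_closed (U V : lmodType R) (f : {linear U -> V})
  (S : submodClosed U) : subsemimod_closed (im_sub f S).
Proof.
split; first split.
- by apply/asboolP; exists 0; rewrite ?rpred0 ?linear0.
- move=> _ _ /asboolP[x Sx <-] /asboolP[y Sy <-]; apply/asboolP.
  by exists (x + y); rewrite ?rpredD ?linearD.
- move=> a _ /asboolP[x Sx <-]; apply/asboolP.
  by exists (a *: x); rewrite ?rpredZ ?linearZ.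
Qed.
HB.instance Definition _ (U V : lmodType R) (f : {linear U -> V})
    (S : submodClosed U) :=
  GRing.isSubmodClosed.Build R V (im_sub f S) (im_sub_closed f S).

(* the kernel of the restriction of f to S *)
Definition ker_sub (U V : lmodType R) (f : {linear U -> V})
    (S : submodClosed U) : {pred U} :=
  fun x => (x \in S) && (f x == 0).

Fact ker_sub_closed (U V : lmodType R) (f : {linear U -> V})
  (S : submodClosed U) : subsemimod_closed (ker_sub f S).
Proof.
split; first split.
- by apply/andP; rewrite rpred0 linear0.
- move=> x y /andP[Sx /eqP fx] /andP[Sy /eqP fy]; apply/andP.
  by rewrite rpredD // linearD fx fy addr0.
- move=> a x /andP[Sx /eqP fx]; apply/andP.
  by rewrite rpredZ // linearZ fx /= scaler0.
Qed.
HB.instance Definition _ (U V : lmodType R) (f : {linear U -> V})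
    (S : submodClosed U) :=
  GRing.isSubmodClosed.Build R U (ker_sub f S) (ker_sub_closed f S).

End Submodules.

Section DirectSum.
Variables (R : comNzRingType) (n : nat) (M : 'I_n -> lmodType R).

Definition dsum : Type := {dffun forall i : 'I_n, M i}.

HB.instance Definition _ := Choice.on dsum.

Definition dsum_zero : dsum := [ffun i => 0 : M i].
Definition dsum_opp (f : dsum) : dsum := [ffun i => - f i : M i].
Definition dsum_add (f g : dsum) : dsum := [ffun i => f i + g i : M i].
Definition dsum_scale (a : R) (f : dsum) : dsum := [ffun i => a *: f i : M i].

Let dsum_addA : associative dsum_add.
Proof. by move=> f g h; apply/ffunP=> i; rewrite !ffunE addrA. Qed.
Let dsum_addC : commutative dsum_add.
Proof. by move=> f g; apply/ffunP=> i; rewrite !ffunE addrC. Qed.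
Let dsum_add0 : left_id dsum_zero dsum_add.
Proof. by move=> f; apply/ffunP=> i; rewrite !ffunE add0r. Qed.
Let dsum_addN : left_inverse dsum_zero dsum_opp dsum_add.
Proof. by move=> f; apply/ffunP=> i; rewrite !ffunE addNr. Qed.

HB.instance Definition _ :=
  GRing.isZmodule.Build dsum dsum_addA dsum_addC dsum_add0 dsum_addN.

Let dsum_scaleA a b f : dsum_scale a (dsum_scale b f) = dsum_scale (a * b) f.
Proof. by apply/ffunP=> i; rewrite !ffunE scalerA. Qed.
Let dsum_scale1 f : dsum_scale 1 f = f.
Proof. by apply/ffunP=> i; rewrite !ffunE scale1r. Qed.
Let dsum_scaleDr a f g :
  dsum_scale a (f + g) = dsum_scale a f + dsum_scale a g.
Proof. by apply/ffunP=> i; rewrite !ffunE scalerDr. Qed.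
Let dsum_scaleDl f a b :
  dsum_scale (a + b) f = dsum_scale a f + dsum_scale b f.
Proof. by apply/ffunP=> i; rewrite !ffunE scalerDl. Qed.

HB.instance Definition _ := GRing.Zmodule_isLmodule.Build R dsum
  dsum_scaleA dsum_scale1 dsum_scaleDr dsum_scaleDl.

End DirectSum.

Section CommutativeAlgebra.
Variable R : comNzRingType.
Implicit Types (N V E : lmodType R) (A B J : set R).

Definition fin_gen N : Prop :=
  exists n (g : 'I_n -> N), forall x, exists c : 'I_n -> R,
    x = \sum_(i < n) c i *: g i.

Definition noetherian : Prop :=
  forall J : submodClosed R^o, fin_gen (submod J).

(* [idealr R] is the type of proper ideals of R. *)
Definition maximal_ideal (P : idealr R) : Prop :=
  forall Q : idealr R, {subset P <= Q} -> Q =i P.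

Definition local_ring (m : idealr R) : Prop :=
  maximal_ideal m /\ (forall P : idealr R, maximal_ideal P -> P =i m).

Definition ann N : set R := [set r | forall x : N, r *: x = 0].

Definition ideal_mul A B : set R :=
  [set r | exists n (a b : 'I_n -> R),
    (forall i, A (a i) /\ B (b i)) /\ r = \sum_(i < n) a i * b i].

Definition ideal_exp J (k : nat) : set R := iter k (ideal_mul J) setT.

(* Chains P_0 < ... < P_k of prime ideals, all containing J; only the values of
   P at 0, ..., k matter. *)
Definition prime_chain J (k : nat) : Prop :=
  exists P : nat -> prime_idealr R,
    (forall x, J x -> x \in P 0%N) /\
    (forall i, (i < k)%N ->
       {subset P i <= P i.+1} /\ ~ {subset P i.+1 <= P i}).

(* The Krull dimension of R / J, for an ideal J; it is -oo if J = R. *)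
Definition dim_quot J : \bar int :=
  supremum -oo%E [set k%:Z%:E%E | k in prime_chain J].

Definition dim N : \bar int := dim_quot (ann N).

Definition injective_module E : Prop :=
  forall (U V : lmodType R) (f : {linear U -> V}) (g : {linear U -> E}),
    injective f -> exists h : {linear V -> E}, forall x, h (f x) = g x.

Record injective_resolution N := InjectiveResolution {
  res : nat -> lmodType R;
  res_aug : {linear N -> res 0%N};
  res_diff : forall i, {linear res i -> res i.+1};
  res_injective : forall i, injective_module (res i);
  res_aug_inj : injective res_aug;
  res_exact0 : forall x, res_diff 0%N x = 0 <-> exists y, res_aug y = x;
  res_exact : forall i x,
    res_diff i.+1 x = 0 <-> exists y, res_diff i y = x
}.

Section LocalCohomology.
Variable m : idealr R.

(* Gamma_m(N) = H^0_m(N), as a submodule of N *)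
Definition torsion N : {pred N} := fun x =>
  `[< exists k, forall r, ideal_exp [set` m] k r -> r *: x = 0 >].

Let torsion_le N (x : N) k l : (k <= l)%N ->
  (forall r, ideal_exp [set` m] k r -> r *: x = 0) ->
  (forall r, ideal_exp [set` m] l r -> r *: x = 0).
Proof.
move=> /subnK<-; elim: (l - k)%N => [//|j IH] kx _ [n [a [b [ab ->]]]].
rewrite scaler_suml big1 // => i _; have [_ bi] := ab i.
by rewrite -scalerA (IH kx _ bi) scaler0.
Qed.

Fact torsion_closed N : subsemimod_closed (@torsion N).
Proof.
split; first split.
- by apply/asboolP; exists 0%N => r _; rewrite scaler0.
- move=> x y /asboolP[k kx] /asboolP[l ly]; apply/asboolP.
  exists (maxn k l) => r rk; rewrite scalerDr.
  rewrite (torsion_le (leq_maxl k l) kx rk).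
  by rewrite (torsion_le (leq_maxr k l) ly rk) addr0.
- move=> a x /asboolP[k kx]; apply/asboolP; exists k => r rk.
  by rewrite scalerA mulrC -scalerA kx // scaler0.
Qed.
HB.instance Definition _ N :=
  GRing.isSubmodClosed.Build R N (@torsion N) (@torsion_closed N).

Section Cohomology.
Variables (N : lmodType R) (I : injective_resolution N).

Definition lc_cocycles i : submodClosed (res I i) :=
  ker_sub (res_diff I i) (@torsion (res I i)).

Definition lc_coboundaries i : submodClosed (res I i) :=
  match i return submodClosed (res I i) with
  | 0%N => @zero_sub R (res I 0%N)
  | j.+1 => im_sub (res_diff I j) (@torsion (res I j))
  end.

(* H^i(Gamma_m(I)): the i-th right derived functor of Gamma_m at N, computed
   with the injective resolution I. *)
Definition local_cohomology i : lmodType R :=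
  subquot (lc_cocycles i) (lc_coboundaries i).

End Cohomology.

(* The annihilator of H^i_m(N). Injective resolutions exist, and H^i_m(N) does
   not depend, up to isomorphism, on the one that is used to compute it. *)
Definition lc_ann (i : nat) N : set R :=
  [set r | exists I : injective_resolution N, ann (local_cohomology I i) r].

(* The product of the lc_ann i N for 0 <= i < dim N; [fine] sends -oo to 0, so
   that the product is empty for N = 0, and dim N < +oo for finitely generated
   modules over a Noetherian local ring. *)
Definition lc_ann_prod N : set R :=
  \big[ideal_mul/setT]_(i < `|fine (dim N)|%N) lc_ann i N.

Definition one_cohen_macaulay N : Prop :=
  (dim_quot (lc_ann_prod N) <= 1%:E)%E.

(* D is the largest submodule of N of dimension less than s *)
Definition largest_dim_lt N (s : \bar int) (D : submodClosed N) : Prop :=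
  (dim (submod D) < s)%E /\
  forall E : submodClosed N, (dim (submod E) < s)%E -> {subset E <= D}.

Definition dimension_filtration N (t : nat) (D : nat -> submodClosed N) :
    Prop :=
  [/\ D 0%N =i predT,
      D t =i @torsion N,
      forall i, (i < t)%N -> {subset D i.+1 <= D i} &
      forall i, (i < t)%N -> largest_dim_lt (dim (submod (D i))) (D i.+1)].

Definition seq_one_cohen_macaulay N : Prop :=
  exists t (D : nat -> submodClosed N),
    dimension_filtration t D /\
    forall i, (i < t)%N -> one_cohen_macaulay (subquot (D i) (D i.+1)).

End LocalCohomology.
End CommutativeAlgebra.

(* Main.v *)
Require Import Defs.
From HB Require Import structures.
From mathcomp Require Import all_boot all_order all_algebra.
From mathcomp Require Import generic_quotient ring_quotient.
From mathcomp Require Import zify.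
From mathcomp Require Import boolp classical_sets constructive_ereal functions.

(** For each s let N_{<=s} and N_{<s} be the largest submodules of N of
    dimension at most s and less than s. The dimension filtration of N consists
    of the N_{<=s} at which the dimension jumps, so N is sequentially
    1-Cohen-Macaulay if and only if every layer N_{<=s} / N_{<s} is
    1-Cohen-Macaulay ([seq_one_cohen_macaulay_layers]). A layer is zero or has
    dimension exactly s, and layers are functorial in N, because a linear map
    cannot raise the dimension of a submodule ([largest_dim_map]). Hence the
    layer of a direct sum is the direct sum of the layers: the projections and
    injections induce maps between the layers ([dim_layer_map]) that satisfy the
    same identities.

    It remains to see that a finite direct sum X of modules Y_k, each of them
    zero or of dimension s, is 1-Cohen-Macaulay if and only if every Y_k is. A
    prime lies over the product of the annihilators of local cohomology if and
    only if it lies over one of its factors ([lc_ann_prod_prime]). Local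
    cohomology is additive, so the annihilator of H^j(X) is the intersection of
    the annihilators of the H^j(Y_k), and a prime over this finite intersection
    lies over one of its terms ([one_cohen_macaulay_summand],
    [one_cohen_macaulay_sum]).

    Two bodies of theory support this. First, additivity of local cohomology
    and its independence of the resolution come from a single comparison of
    injective resolutions ([ann_local_cohomology_factor]); their existence rests
    on Q/Z being an injective abelian group and on coinduction to R
    ([quotient_embeds_in_injective]). Secondly, the dimension filtration exists
    because finitely generated modules are Noetherian, and it ends at the
    torsion submodule because, over a local ring, dimension at most zero means
    being torsion ([dim_le0_torsion], [dim_torsion]). It is finite because
    dimensions lie in the well-ordered set of -oo, the natural numbers and
    +oo. *)

Set Implicit Arguments.
Unset Strict Implicit.
Unset Printing Implicit Defensive.

Import Defs Order.TTheory GRing.Theory Num.Theory.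
Local Open Scope ring_scope.
Local Open Scope quotient_scope.

(** * Submodules, linear maps and dependent choice *)

Lemma submodule_of_set (R : comNzRingType) (V : lmodType R) (P : V -> Prop) :
  P 0 -> (forall x y, P x -> P y -> P (x + y)) ->
  (forall a x, P x -> P (a *: x)) ->
  exists S : submodClosed V, forall x, x \in S <-> P x.
Proof.
move=> P0 PD PZ; pose p : {pred V} := fun x => `[< P x >].
have cl : GRing.subsemimod_closed p.
  split; first split.
  - exact/asboolP.
  - by move=> x y /asboolP Px /asboolP Py; apply/asboolP/PD.
  - by move=> a x /asboolP Px; apply/asboolP/PZ.
pose i := GRing.isSubmodClosed.Build R V p cl.
pose S : submodClosed V := HB.pack p i.
by exists S => x; split=> [/asboolP|Px] //; apply/asboolP.
Qed.

Lemma submodB (R : comNzRingType) (V : lmodType R) (S : submodClosed V) x y :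
  x \in S -> y \in S -> x - y \in S.
Proof. by move=> Sx Sy; rewrite rpredD // -scaleN1r rpredZ. Qed.

Lemma linear_of_function (R : comNzRingType) (U V : lmodType R) (f : U -> V) :
  (forall a x y, f (a *: x + y) = a *: f x + f y) ->
  exists h : {linear U -> V}, h =1 f.
Proof.
move=> lf; pose i := GRing.isLinear.Build R U V *:%R f lf.
by pose h : {linear U -> V} := HB.pack f i; exists h.
Qed.

Lemma dependent_choice_family (T : nat -> Type)
    (r : forall i, T i -> T i.+1 -> Prop) (x0 : T 0%N) :
  (forall i x, exists y, @r i x y) ->
  exists s : forall i, T i, s 0%N = x0 /\ forall i, r i (s i) (s i.+1).
Proof.
move=> ex; pose next i x := projT1 (cid (ex i x)).
exists (nat_rect T x0 next); split=> // i /=.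
exact: projT2 (cid (ex i _)).
Qed.

(** * Divisible groups and characters *)

Lemma int_subgroup_principal (K : int -> Prop) :
  K 0 -> (forall k l, K k -> K l -> K (k - l)) ->
  exists n : nat, K n%:Z /\ forall k, K k -> exists q, k = q * n%:Z.
Proof.
move=> K0 KB.
have KN k : K k -> K (- k) by move=> Kk; rewrite -sub0r; apply: (KB).
have KD k l : K k -> K l -> K (k + l).
  by move=> Kk Kl; rewrite -[l]opprK; apply: KB => //; exact: KN.
have [ex|nn] := pselect (exists n : nat, (0 < n)%N && `[< K n%:Z >]); last first.
  have n0 n : K n.+1%:Z -> False.
    by move=> Kn; apply: nn; exists n.+1; exact/asboolP.
  exists 0%N; split=> // -[[|n]|n] Kk; first by exists 0.
    by case: (n0 n).
  by case: (n0 n); rewrite -[n.+1%:Z]opprK -NegzE; exact: KN.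
have := ex_minnP ex; case=> n /andP[n0 /asboolP Kn] nmin; exists n; split=> // k Kk.
have KMn j : K (j%:Z * n%:Z).
  elim: j => [|j IH]; first by rewrite mul0r.
  by rewrite intS mulrDl mul1r; exact: KD.
have KM (q : int) : K (q * n%:Z).
  by case: q => j; [exact: KMn|rewrite NegzE mulNr; apply/KN/KMn].
have n0' : n%:Z != 0 by rewrite eqz_nat -lt0n.
have ra : `|(k %% n)%Z|%N%:Z = (k %% n)%Z by rewrite gez0_abs ?modz_ge0.
exists (k %/ n)%Z; rewrite {1}(divz_eq k n) -ra.
have [->|rp] := posnP `|(k %% n)%Z|%N; first by rewrite addr0.
have : (n <= `|(k %% n)%Z|)%N.
  by apply: nmin; rewrite rp; apply/asboolP; rewrite ra; exact: KB.
by rewrite -lez_nat ra leNgt ltz_pmod // ltz_nat.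
Qed.

Section Divisible.
Variables (V D : zmodType).

Let pairN (v : V) (d : D) : - (v, d) = (- v, - d). Proof. by []. Qed.

Let pairB (v w : V) (d e : D) : (v, d) - (w, e) = (v - w, d - e).
Proof. by []. Qed.

(** Graphs of homomorphisms to D from subgroups of V. *)
Definition partial_hom (G : set (V * D)) : Prop :=
  [/\ G 0, (forall p q, G p -> G q -> G (p - q)) & forall d, G (0, d) -> d = 0].

Lemma partial_homD G p q : partial_hom G -> G p -> G q -> G (p + q).
Proof.
move=> [G0 GB _] Gp Gq; rewrite -[q]opprK; apply: (GB) => //.
by rewrite -sub0r; apply: GB.
Qed.

Lemma partial_homMz G p k : partial_hom G -> G p -> G (p *~ k).
Proof.
move=> hG Gp; have hn n : G (p *+ n).
  elim: n => [|n IH]; first by case: hG.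
  by rewrite mulrS; apply: partial_homD.
case: k => n /=; first exact: hn.
by rewrite NegzE mulrNz -sub0r; case: hG => G0 GB _; apply: GB => //; apply: hn.
Qed.

Hypothesis divD : forall n (d : D), (0 < n)%N -> exists e, e *+ n = d.

Let mzE (v : V) (d : D) k : (v, d) *~ k = (v *~ k, d *~ k).
Proof.
have hn n : (v, d) *+ n = (v *+ n, d *+ n).
  by elim: n => [|n IH] //; rewrite !mulrS IH.
by case: k => n; rewrite ?NegzE ?mulrNz -!pmulrn hn.
Qed.

(** The integers k with k v in the domain are the multiples of some n; an n-th
    part of the value at n v is a consistent value at v. *)
Lemma partial_hom_adjoin G v : partial_hom G ->
  exists d, partial_hom [set p | exists q k, G q /\ p = q + (v, d) *~ k].
Proof.
move=> hG; case: (hG) => G0 GB Gf.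
have [d hd] : exists d, forall k e, G (v *~ k, e) -> e = d *~ k.
  have [||n [[e Gne] nK]] :=
    @int_subgroup_principal (fun k => exists e, G (v *~ k, e)).
  - by exists 0; rewrite mulr0z.
  - move=> k l [e Gk] [e' Gl]; exists (e - e'); rewrite mulrzBr -pairB.
    exact: GB.
  have [d de] : exists d, d *+ n = e.
    case: n Gne {nK} => [|n] Gne; last exact: divD.
    by exists 0; rewrite mulr0n; apply/esym/Gf; rewrite -(mulr0z v).
  exists d => k e' Gk; have [q kq] := nK _ (ex_intro _ e' Gk).
  have := GB _ _ Gk (partial_homMz q hG Gne).
  rewrite mzE pairB -mulrzA [n%:Z * q]mulrC -kq subrr => /Gf/eqP.
  by rewrite subr_eq0 => /eqP->; rewrite -de pmulrn -mulrzA mulrC -kq.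
exists d; split.
- by exists 0, 0; rewrite mulr0z addr0.
- move=> _ _ [q [k [Gq ->]]] [q' [k' [Gq' ->]]]; exists (q - q'), (k - k').
  by split; [exact: GB|rewrite mulrzBr opprD addrACA].
- move=> e [[w e'] [k [Gq]]]; rewrite mzE => -[/esym/eqP].
  rewrite addrC addr_eq0 => /eqP vk ->.
  have := GB _ _ G0 Gq; rewrite sub0r pairN -vk => /hd <-.
  by rewrite subrr.
Qed.

(** Baer's extension argument: a maximal partial homomorphism is defined
    everywhere, since otherwise it could be extended to one more cyclic
    subgroup by dividing in [D]. *)
Lemma partial_hom_extend G : partial_hom G ->
  exists h : V -> D, (forall x y, h (x - y) = h x - h y) /\
    forall x d, G (x, d) -> h x = d.
Proof.
move=> hG.
(* The union of the empty chain is empty, hence the first alternative. *)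
pose P (H : set (V * D)) := H = set0 \/ (G `<=` H)%classic /\ partial_hom H.
have [F FP Ftot|M [PM Mmax]] := @Zorn_bigcup _ P.
  have [F0|/existsNP[H0 /not_implyP[FH0 H0n]]] :=
    pselect (forall H, F H -> H = set0).
    left; rewrite predeqE => p; split=> // -[H FH].
    by rewrite (F0 _ FH).
  right; have Fh H p : F H -> H p -> (G `<=` H)%classic /\ partial_hom H.
    by move=> FH Hp; case: (FP _ FH) => // H00; move: Hp; rewrite H00.
  have [p0 H0p] : exists p, H0 p.
    apply: contrapT => H0N; apply: H0n; rewrite predeqE => p; split=> // Hp.
    by case: H0N; exists p.
  have [GH0 hH0] := Fh _ _ FH0 H0p.
  split; first by move=> p Gp; exists H0 => //; apply: GH0.
  split.
  - by exists H0 => //; case: hH0.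
  - move=> p q [H FH Hp] [K FK Kq].
    have [HK|KH] := Ftot _ _ FH FK.
      by exists K => //; have [_ [_ + _]] := Fh _ _ FK Kq; apply=> //; apply: HK.
    by exists H => //; have [_ [_ + _]] := Fh _ _ FH Hp; apply=> //; apply: KH.
  - by move=> d [H FH Hd]; have [_ [_ _]] := Fh _ _ FH Hd; apply.
have G0 : G 0 by case: hG.
have [GM hM] : (G `<=` M)%classic /\ partial_hom M.
  case: PM => // M0; exfalso; apply: (Mmax G); last by right; split.
  split; first by rewrite M0.
  by rewrite M0 => /(_ _ G0).
have [M0 MB Mf] := hM.
have Mtot v : exists d, M (v, d).
  apply: contrapT => nv; have [d hd] := partial_hom_adjoin v hM.
  have MH : (M `<=` [set p | exists q k, M q /\ p = q + (v, d) *~ k])%classic.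
    by move=> p Mp; exists p, 0; rewrite mulr0z addr0.
  apply: (Mmax _ _ (or_intror (conj (subset_trans GM MH) hd))).
  split=> // /(_ (v, d)) HM; apply: nv; exists d; apply: HM.
  by exists 0, 1; rewrite add0r mulr1z.
have Mu x d e : M (x, d) -> M (x, e) -> d = e.
  move=> Md Me; apply/eqP; rewrite -subr_eq0; apply/eqP/Mf.
  by have := MB _ _ Md Me; rewrite pairB subrr.
have [h hh] := choice Mtot; exists h; split=> [x y|x d Gx].
  by apply: Mu (hh _) _; exact: MB (hh x) (hh y).
by apply: Mu (hh _) _; apply: GM.
Qed.

End Divisible.

(** * Enough injective modules *)

(** Z as a subgroup of Q, in the form expected by the quotient construction. *)
Definition integral_rat : {pred rat} := fun x => x \is a Num.int.

Fact integral_rat_closed : zmod_closed integral_rat.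
Proof. by split=> [|x y]; [exact: rpred0|exact: rpredB]. Qed.
HB.instance Definition _ :=
  GRing.isZmodClosed.Build rat integral_rat integral_rat_closed.

Definition rat_mod_int : Type := Quotient.quot integral_rat.
HB.instance Definition _ := GRing.Zmodule.on rat_mod_int.

Lemma rat_mod_int_divisible n (d : rat_mod_int) :
  (0 < n)%N -> exists e, e *+ n = d.
Proof.
move=> n0; elim/(@quotW _ (Quotient.quot integral_rat)): d => x.
exists (\pi_(Quotient.quot integral_rat)%qT (x / n%:R)).
rewrite -raddfMn /= -[x / _ *+ n]mulr_natr divfK //.
by rewrite pnatr_eq0 -lt0n.
Qed.

Lemma rat_mod_int_inverse n : (1 < n)%N ->
  exists2 c : rat_mod_int, c <> 0 & c *+ n = 0.
Proof.
move=> n1; have n0 : n%:R != 0 :> rat by rewrite pnatr_eq0 -lt0n ltnW.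
exists (\pi_(Quotient.quot integral_rat)%qT (n%:R^-1)).
  rewrite -(raddf0 (\pi_(Quotient.quot integral_rat)%qT)) => /eqP.
  rewrite -Quotient.idealrBE subr0 /integral_rat unfold_in => /intrP[k hk].
  have : (k * n%:Z)%:~R = 1%:~R :> rat.
    by rewrite intrM -hk -pmulrn mulVf.
  move=> /intr_inj /(congr1 absz); rewrite abszM /= => /eqP.
  by rewrite muln_eq1 => /andP[_ /eqP n1']; rewrite n1' in n1.
rewrite -raddfMn /= -[_^-1 *+ n]mulr_natr mulVf //.
rewrite -(raddf0 (\pi_(Quotient.quot integral_rat)%qT)); apply/eqP.
by rewrite -Quotient.idealrBE subr0; exact: rpred1.
Qed.

(** The value at x is 1/n when x has order n > 1 modulo S, and 1/2 when it has
    infinite order; Q/Z being injective, this extends to V. *)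
Lemma separating_character (V : zmodType) (S : V -> Prop) x :
  S 0 -> (forall u v, S u -> S v -> S (u - v)) -> ~ S x ->
  exists h : V -> rat_mod_int, [/\ forall u v, h (u - v) = h u - h v,
    forall u, S u -> h u = 0 & h x <> 0].
Proof.
move=> S0 SB nSx.
have SN u : S u -> S (- u) by move=> Su; rewrite -sub0r; apply: (SB).
have [||n [Sn nK]] := @int_subgroup_principal (fun k => S (x *~ k)).
- by rewrite mulr0z.
- by move=> k l Sk Sl; rewrite mulrzBr; apply: SB.
have [c c0 cn] : exists2 c : rat_mod_int, c <> 0 & c *+ n = 0.
  case: n Sn {nK} => [|[|n]] Sn; last exact: rat_mod_int_inverse.
  - by have [c c0 _] := @rat_mod_int_inverse 2 isT; exists c.
  - by case: nSx; rewrite -[x]mulr1z.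
have hc k : S (x *~ k) -> c *~ k = 0.
  by move=> /nK[q ->]; rewrite mulrC mulrzA -pmulrn cn mul0rz.
pose G : set (V * rat_mod_int) :=
  [set p | exists u k, S u /\ p = (u + x *~ k, c *~ k)]%classic.
have hG : partial_hom G.
  split.
  - by exists 0, 0; rewrite !mulr0z addr0.
  - move=> _ _ [u [k [Su ->]]] [v [l [Sv ->]]]; exists (u - v), (k - l).
    split; first exact: SB.
    by rewrite !mulrzBr addrACA -opprD.
  - move=> d [u [k [Su [/esym/eqP]]]]; rewrite addrC addr_eq0 => /eqP xk ->.
    by apply: hc; rewrite xk; apply: SN.
have [h [hB hG']] := partial_hom_extend rat_mod_int_divisible hG.
exists h; split=> // [u Su|].
  by apply: hG'; exists u, 0; rewrite !mulr0z addr0.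
suff -> : h x = c by [].
by apply: hG'; exists 0, 1; rewrite !mulr1z add0r.
Qed.

Lemma morphismD (U V : zmodType) (f : U -> V) :
  (forall x y, f (x - y) = f x - f y) -> forall x y, f (x + y) = f x + f y.
Proof.
move=> fB x y; have f0 : f 0 = 0 by have := fB 0 0; rewrite !subrr.
by rewrite -{1}[y]opprK fB -[- y]sub0r fB f0 sub0r opprK.
Qed.

Section Coinduced.
Variables (R : comNzRingType) (D : zmodType).

(** The R-module of additive maps from R to D, on which R acts by
    precomposition with multiplication. *)
Record coinduced := Coinduced {
  coind_fun : R -> D;
  coind_additive : forall x y, coind_fun (x - y) = coind_fun x - coind_fun y
}.

Lemma coinduced_ext (e e' : coinduced) : coind_fun e =1 coind_fun e' -> e = e'.
Proof.
case: e e' => f fB [g gB] /= /funext fg; move: gB; rewrite -fg => gB.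
by congr Coinduced; exact: Prop_irrelevance.
Qed.

HB.instance Definition _ := gen_eqMixin coinduced.
HB.instance Definition _ := gen_choiceMixin coinduced.

Let zero := @Coinduced (fun=> 0) (fun _ _ => esym (subr0 0)).
Let opp (e : coinduced) : coinduced.
Proof.
exists (fun r => - coind_fun e r) => x y.
by rewrite coind_additive opprB opprK addrC.
Defined.
Let add (e e' : coinduced) : coinduced.
Proof.
exists (fun r => coind_fun e r + coind_fun e' r) => x y.
by rewrite !coind_additive opprD addrACA.
Defined.
Let scale (a : R) (e : coinduced) : coinduced.
Proof.
exists (fun r => coind_fun e (r * a)) => x y.
by rewrite mulrBl coind_additive.
Defined.

Let addA : associative add.
Proof. by move=> e f g; apply: coinduced_ext => r /=; rewrite addrA. Qed.
Let addC : commutative add.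
Proof. by move=> e f; apply: coinduced_ext => r /=; rewrite addrC. Qed.
Let add0 : left_id zero add.
Proof. by move=> e; apply: coinduced_ext => r /=; rewrite add0r. Qed.
Let addN : left_inverse zero opp add.
Proof. by move=> e; apply: coinduced_ext => r /=; rewrite addNr. Qed.

HB.instance Definition _ := GRing.isZmodule.Build coinduced addA addC add0 addN.

Let scaleA a b e : scale a (scale b e) = scale (a * b) e.
Proof. by apply: coinduced_ext => r /=; rewrite mulrA. Qed.
Let scale1 e : scale 1 e = e.
Proof. by apply: coinduced_ext => r /=; rewrite mulr1. Qed.
Let scaleDr a (e f : coinduced) : scale a (e + f) = scale a e + scale a f.
Proof. exact: coinduced_ext. Qed.
Let scaleDl e a b : scale (a + b) e = scale a e + scale b e.
Proof.
apply: coinduced_ext => r /=; rewrite mulrDr.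
by rewrite (morphismD (@coind_additive e)).
Qed.

HB.instance Definition _ := GRing.Zmodule_isLmodule.Build R coinduced
  scaleA scale1 scaleDr scaleDl.

(** By adjunction, R-linear maps from V to the coinduced module are additive
    maps from V to D, obtained by evaluation at 1. *)
Lemma coinduced_injective :
  (forall n (d : D), (0 < n)%N -> exists e, e *+ n = d) ->
  injective_module coinduced.
Proof.
move=> divD U V f g finj.
pose G : set (V * D) := [set p | exists u, p = (f u, coind_fun (g u) 1)]%classic.
have hG : partial_hom G.
  split.
  - by exists 0; rewrite !linear0.
  - by move=> _ _ [u ->] [v ->]; exists (u - v); rewrite !linearB.
  - by move=> d [u [/esym/eqP]]; rewrite -(linear0 f) => /eqP/finj -> ->;
      rewrite linear0.
have [h [hB hG']] := partial_hom_extend divD hG.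
have hlB x r s : h ((r - s) *: x) = h (r *: x) - h (s *: x).
  by rewrite scalerBl hB.
have [|k hk] := @linear_of_function R V coinduced (fun x => Coinduced (hlB x)).
  move=> a x y; apply: coinduced_ext => r /=.
  by rewrite scalerDr (morphismD hB) scalerA.
exists k => u; apply: coinduced_ext => r; rewrite hk /=.
rewrite -linearZ; have -> : coind_fun (g u) r = coind_fun (g (r *: u)) 1.
  by rewrite linearZ /= mul1r.
by apply: hG'; exists (r *: u).
Qed.

End Coinduced.

(** The existence of enough injectives, applied to V / S and stated on V. The
    target is the module coinduced from the product of copies of Q/Z indexed by
    the characters of V that vanish on S; those separate V / S. *)
Lemma quotient_embeds_in_injective (R : comNzRingType) (V : lmodType R)
    (S : submodClosed V) :
  exists (E : lmodType R) (f : {linear V -> E}),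
    injective_module E /\ forall x, f x = 0 <-> x \in S.
Proof.
pose X := {h : V -> rat_mod_int |
  (forall u v, h (u - v) = h u - h v) /\ forall u, u \in S -> h u = 0}.
pose D : zmodType := X -> rat_mod_int.
have divD n (d : D) : (0 < n)%N -> exists e, e *+ n = d.
  move=> n0; have [e he] := choice (fun x => rat_mod_int_divisible (d x) n0).
  exists e; apply/funext => x; rewrite -he.
  by elim: (n) => [|k IH] //; rewrite !mulrS -IH.
have fB x r s : (fun c : X => sval c ((r - s) *: x)) =
    (fun c : X => sval c (r *: x)) - (fun c : X => sval c (s *: x)) :> D.
  by apply/funext => -[c [cB cS]] /=; rewrite scalerBl cB.
have [|f hf] := @linear_of_function R V (coinduced R D)
    (fun x => @Coinduced R D (fun r c => sval c (r *: x)) (fB x)).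
  move=> a x y; apply: coinduced_ext => r; apply/funext => -[c [cB cS]] /=.
  by rewrite scalerDr scalerA (morphismD cB).
exists (coinduced R D), f; split; first exact: coinduced_injective.
move=> x; rewrite hf; split=> [fx0|xS].
  apply: contrapT => /negP nS.
  have [||c [cB cS cx]] := @separating_character V (fun v => v \in S) x _ _ (negP nS).
  - exact: rpred0.
  - exact: submodB.
  pose c' : X := exist _ c (conj cB cS).
  apply: cx; have := congr1 (fun e => coind_fun e 1 c') fx0.
  by rewrite /= scale1r.
apply: coinduced_ext => r; apply/funext => -[c [cB cS]] /=.
by apply: cS; rewrite rpredZ.
Qed.

(** The map g descends to the image of d and extends from there to W. *)
Lemma injective_factor (R : comNzRingType) (V W E : lmodType R)
    (d : {linear V -> W}) (g : {linear V -> E}) :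
  injective_module E -> (forall x, d x = 0 -> g x = 0) ->
  exists h : {linear W -> E}, forall x, h (d x) = g x.
Proof.
move=> injE dg.
have [||| S hS] := @submodule_of_set R W (fun y => exists x, d x = y).
- by exists 0; rewrite linear0.
- by move=> _ _ [x <-] [y <-]; exists (x + y); rewrite linearD.
- by move=> a _ [x <-]; exists (a *: x); rewrite linearZ.
have [s hs] : exists s : submod S -> V, forall z, d (s z) = val z.
  have ex (z : submod S) : exists x, d x = val z by apply/hS/valP.
  by have [s hs] := choice ex; exists s.
have dgB x y : d x = d y -> g x = g y.
  move=> dxy; apply/eqP; rewrite -subr_eq0 -linearB; apply/eqP/dg.
  by rewrite linearB dxy subrr.
have [|g' hg'] := @linear_of_function R (submod S) E (fun z => g (s z)).
  move=> a x y; rewrite -linearP; apply: dgB.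
  by rewrite linearD linearZ !hs [LHS]linearD linearZ.
have [h hh] := injE (submod S) W (val : {linear submod S -> W}) g' val_inj.
exists h => x; have Sdx : d x \in S by apply/hS; exists x.
by rewrite -[d x](SubK (submod S) Sdx) hh hg'; apply: dgB; rewrite hs SubK.
Qed.

(** A step takes a module V with a submodule S to an injective module E with a
    map V -> E of kernel S, and goes on with E and the image of V. *)
Lemma injective_resolution_exists (R : comNzRingType) (N : lmodType R) :
  exists _ : injective_resolution N, True.
Proof.
pose state := {V : lmodType R & submodClosed V}.
pose data (p : state) :=
  {E : lmodType R & {f : {linear projT1 p -> E} |
     injective_module E /\ forall x, f x = 0 <-> x \in projT2 p}}.
have ex p : data p.
  have /cid[E /cid[f hf]] := quotient_embeds_in_injective (projT2 p).
  by exists E, f.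
pose E (p : state) := projT1 (ex p).
pose f (p : state) : {linear projT1 p -> E p} := sval (projT2 (ex p)).
have fP (p : state) : injective_module (E p) /\ forall x, f p x = 0 <-> x \in projT2 p.
  exact: svalP (projT2 (ex p)).
have full (V : lmodType R) : {S : submodClosed V | forall x, x \in S}.
  have /cid[S hS] : exists S : submodClosed V, forall x, x \in S <-> True.
    exact: submodule_of_set.
  by exists S => x; apply/hS.
pose next (p : state) : state :=
  existT _ (E p) (im_sub (f p) (sval (full _)) : submodClosed _).
pose p0 : state :=
  existT _ N (@zero_sub R N : submodClosed _).
pose st i := iter i next p0.
have imP (p : state) y : y \in im_sub (f p) (sval (full _)) <-> exists x, f p x = y.
  split=> [/asboolP[x _ <-]|[x <-]]; first by exists x.
  by apply/asboolP; exists x => //; apply: svalP (full _) x.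
unshelve econstructor; last by [].
refine (@InjectiveResolution R N (fun i => E (st i)) (f (st 0%N))
  (fun i => f (st i.+1)) _ _ _ _).
- by move=> i; case: (fP (st i)).
- apply: raddf_inj => x /(proj2 (fP p0) x).1.
  by rewrite /= unfold_in => /eqP.
- by move=> x; apply: (iff_trans ((fP (st 1%N)).2 x)); exact: imP.
- by move=> i x; apply: (iff_trans ((fP (st i.+2)).2 x)); exact: imP.
Qed.

(** * Subquotients *)

Section Subquotient.
Variables (R : comNzRingType) (V : lmodType R) (A B : submodClosed V).

Definition subquot_pi (x : submod A) : subquot A B :=
  \pi_(Quotient.quot (sub_trace B)) x.

Lemma subquot_pi_linear a x y :
  subquot_pi (a *: x + y) = a *: subquot_pi x + subquot_pi y.
Proof.
rewrite /subquot_pi; pose q := Quotient.quot (sub_trace B : zmodClosed (submod A)).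
rewrite [LHS](raddfD (\pi_q : {additive submod A -> q})); congr (_ + _).
rewrite [RHS]/(subquot_scale _ _) /subquot_scale; apply/eqP.
rewrite -Quotient.idealrBE -scalerBr rpredZ //.
by rewrite Quotient.idealrBE reprK.
Qed.

Lemma subquot_pi_surj z : exists x, subquot_pi x = z.
Proof. by exists (repr z); rewrite /subquot_pi reprK. Qed.

Lemma subquot_pi0 x : subquot_pi x = 0 <-> val x \in B.
Proof.
pose q := Quotient.quot (sub_trace B : zmodClosed (submod A)).
have <- : subquot_pi 0 = 0 by exact: (raddf0 (\pi_q : {additive submod A -> q})).
rewrite (rwP eqP) /subquot_pi -Quotient.idealrBE subr0.
by [].
Qed.

Lemma ann_subquot r :
  ann (subquot A B) r <-> forall x, x \in A -> r *: x \in B.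
Proof.
have piZ x : subquot_pi (r *: x) = r *: subquot_pi x.
  by rewrite -[r *: x]addr0 subquot_pi_linear (subquot_pi0 0).2 ?addr0 // raddf0 rpred0.
split=> [rA x Ax|rA z].
  by have := rA (subquot_pi (Sub x Ax)); rewrite -piZ subquot_pi0 linearZ.
have [x <-] := subquot_pi_surj z; rewrite -piZ subquot_pi0 linearZ.
exact/rA/valP.
Qed.

End Subquotient.

(** * Comparison of injective resolutions *)

Lemma diff_diff (R : comNzRingType) (N : lmodType R)
    (I : injective_resolution N) i x : res_diff I i.+1 (res_diff I i x) = 0.
Proof. by apply/res_exact; exists x. Qed.

Section Comparison.
Variables (R : comNzRingType) (A B : lmodType R).
Variables (I : injective_resolution A) (J : injective_resolution B).

Definition chain_map (phi : forall i, {linear res I i -> res J i}) : Prop :=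
  forall i x, phi i.+1 (res_diff I i x) = res_diff J i (phi i x).

Lemma chain_map_lift (f : {linear A -> B}) :
  exists phi : forall i, {linear res I i -> res J i},
    chain_map phi /\ forall x, phi 0%N (res_aug I x) = res_aug J (f x).
Proof.
(* phi_i preserves cocycles, so d phi_i factors through d as phi_{i+1} d *)
pose T i := {phi : {linear res I i -> res J i} |
  forall x, res_diff I i x = 0 -> res_diff J i (phi x) = 0}.
have [|phi0 h0] := @injective_factor R A (res I 0%N) (res J 0%N)
    (res_aug I) (res_aug J \o f) (@res_injective _ _ J 0%N).
  by move=> x; rewrite -(linear0 (res_aug I)) => /res_aug_inj ->; rewrite linear0.
have p0 x : res_diff I 0%N x = 0 -> res_diff J 0%N (phi0 x) = 0.
  by move=> /res_exact0[y <-]; rewrite h0; apply/res_exact0; exists (f y).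
have [|s [s0 hs]] := @dependent_choice_family T
    (fun i p q => forall x, sval q (res_diff I i x) = res_diff J i (sval p x))
    (exist _ phi0 p0).
  move=> i [p hp] /=.
  have [q hq] := @injective_factor R _ (res I i.+1) (res J i.+1)
    (res_diff I i) (res_diff J i \o p) (@res_injective _ _ J i.+1) hp.
  have hq' x : res_diff I i.+1 x = 0 -> res_diff J i.+1 (q x) = 0.
    by move=> /res_exact[y <-]; rewrite hq /= diff_diff.
  by exists (exist _ q hq').
exists (fun i => sval (s i)); split=> [i x|x]; first exact: hs.
by rewrite s0 /= h0.
Qed.

(** Built by degree: theta_{i+1} - d s_i vanishes on the image of d_i, which is
    the kernel of d_{i+1}, so it factors through d_{i+1}. *)
Lemma chain_map_homotopy (theta : forall i, {linear res I i -> res J i}) :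
  chain_map theta -> (forall x, theta 0%N (res_aug I x) = 0) ->
  exists s : forall i, {linear res I i.+1 -> res J i},
    (forall x, theta 0%N x = s 0%N (res_diff I 0%N x)) /\
    forall i x, theta i.+1 x =
      s i.+1 (res_diff I i.+1 x) + res_diff J i (s i x).
Proof.
move=> ct t0.
pose T i := {s : {linear res I i.+1 -> res J i} | forall x,
  res_diff J i (theta i x) = res_diff J i (s (res_diff I i x))}.
have [|s0 h0] := @injective_factor R _ _ _ (res_diff I 0%N) (theta 0%N)
    (@res_injective _ _ J 0%N).
  by move=> x /res_exact0[y <-]; exact: t0.
have p0 x : res_diff J 0%N (theta 0%N x) = res_diff J 0%N (s0 (res_diff I 0%N x)).
  by rewrite h0.
have [|s [e0 hs]] := @dependent_choice_family T (fun i p q => forall x,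
    theta i.+1 x = sval q (res_diff I i.+1 x) + res_diff J i (sval p x))
    (exist _ s0 p0).
  move=> i [p hp] /=.
  have [|g hg] := @linear_of_function R _ _
      (fun x => theta i.+1 x - res_diff J i (p x)).
    by move=> a x y; rewrite !linearD !linearZ /= addrACA.
  have [|q hq] := @injective_factor R _ _ _ (res_diff I i.+1) g
      (@res_injective _ _ J i.+1).
    by move=> x /res_exact[y <-]; rewrite hg ct hp subrr.
  have hq' x : res_diff J i.+1 (theta i.+1 x) =
      res_diff J i.+1 (q (res_diff I i.+1 x)).
    by rewrite hq hg linearB diff_diff subr0.
  by exists (exist _ q hq') => x /=; rewrite hq hg subrK.
exists (fun i => sval (s i)); split=> [x|i x]; last exact: hs.
by rewrite e0 /= h0.
Qed.

End Comparison.

(** * Annihilators of local cohomology *)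

Section LocalCohomologyAnnihilator.
Variables (R : comNzRingType) (m : idealr R).
Implicit Types (N U V : lmodType R).

Lemma torsion_map U V (f : {linear U -> V}) x :
  x \in @torsion R m U -> f x \in @torsion R m V.
Proof.
move=> /asboolP[k kx]; apply/asboolP; exists k => r rk.
by rewrite -linearZ /= kx // linear0.
Qed.

Lemma ann_local_cohomology N (I : injective_resolution N) i r :
  ann (local_cohomology m I i) r <->
  forall x, x \in @torsion R m (res I i) -> res_diff I i x = 0 ->
    r *: x \in lc_coboundaries m I i.
Proof.
apply: (iff_trans (ann_subquot _ _ _)).
split=> [H x Tx dx|H x /andP[Tx /eqP dx]]; last exact: H.
by apply: H; apply/andP; split=> //; apply/eqP.
Qed.

(** If the identity of A factors through the modules B_k, so does the identity
    of the cohomology of A, because chain maps that lift the same linear map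
    are homotopic. A ring element that kills the cohomology of every B_k then
    kills that of A, whatever resolutions are used. *)
Lemma ann_local_cohomology_factor (n : nat) (A : lmodType R)
    (B : 'I_n -> lmodType R) (p : forall k, {linear A -> B k})
    (q : forall k, {linear B k -> A}) (I : injective_resolution A) i r :
  (forall x, \sum_k q k (p k x) = x) ->
  (forall k, lc_ann m i (B k) r) ->
  ann (local_cohomology m I i) r.
Proof.
move=> qp lB; apply/ann_local_cohomology => x Tx dx.
have [J hJ] : exists J : forall k, injective_resolution (B k),
    forall k, ann (local_cohomology m (J k) i) r.
  exists (fun k => projT1 (cid (lB k))) => k; exact: projT2 (cid (lB k)).
pose lp k := projT1 (cid (chain_map_lift I (J k) (p k))).
have lpP k : chain_map (lp k) /\
    forall x, lp k 0%N (res_aug I x) = res_aug (J k) (p k x).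
  exact: projT2 (cid (chain_map_lift I (J k) (p k))).
pose lq k := projT1 (cid (chain_map_lift (J k) I (q k))).
have lqP k : chain_map (lq k) /\
    forall x, lq k 0%N (res_aug (J k) x) = res_aug I (q k x).
  exact: projT2 (cid (chain_map_lift (J k) I (q k))).
(* theta lifts zero, so it is null-homotopic *)
have [theta ht] : exists theta : forall j, {linear res I j -> res I j},
    forall j y, theta j y = y - \sum_k lq k j (lp k j y).
  have ex j : exists t : {linear res I j -> res I j},
      forall y, t y = y - \sum_k lq k j (lp k j y).
    apply: (linear_of_function (f := fun y => y - \sum_k lq k j (lp k j y))).
    move=> a y z; rewrite scalerBr scaler_sumr.
    have -> : \sum_k lq k j (lp k j (a *: y + z)) =
        \sum_k a *: lq k j (lp k j y) + \sum_k lq k j (lp k j z).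
      by rewrite -big_split; apply: eq_bigr => k _; rewrite !linearD !linearZ.
    by rewrite opprD addrACA.
  by exists (fun j => projT1 (cid (ex j))) => j; exact: projT2 (cid (ex j)).
have ct : chain_map theta.
  move=> j y; rewrite !ht [RHS]linearB [in RHS]linear_sum; congr (_ - _).
  by apply: eq_bigr => k _; rewrite (lpP k).1 (lqP k).1.
have t0 y : theta 0%N (res_aug I y) = 0.
  rewrite ht -[X in X - _](congr1 (res_aug I) (qp y)) linear_sum.
  apply/eqP; rewrite subr_eq0; apply/eqP/eq_bigr => k _.
  by rewrite (lpP k).2 (lqP k).2.
have [s [s0 hs]] := chain_map_homotopy ct t0.
have -> : r *: x = r *: theta i x + \sum_k lq k i (r *: lp k i x).
  rewrite ht scalerBr scaler_sumr.
  under [X in _ = _ + X]eq_bigr do rewrite linearZ.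
  by rewrite subrK.
have dlp k : res_diff (J k) i (lp k i x) = 0.
  by rewrite -(lpP k).1 dx linear0.
have lJ k : r *: lp k i x \in lc_coboundaries m (J k) i.
  by apply: (ann_local_cohomology _ _ _).1; [exact: hJ|exact: torsion_map|].
case: i x Tx dx dlp lJ {lB hJ} => [|i] x Tx dx dlp lJ.
  rewrite s0 dx linear0 scaler0 add0r; apply: rpred_sum => k _.
  have /eqP-> := lJ k; rewrite linear0; exact: rpred0.
rewrite hs dx linear0 add0r; apply: rpredD.
  apply/asboolP; exists (r *: s i x); last by rewrite linearZ.
  by rewrite rpredZ // torsion_map.
apply: rpred_sum => k _; have /asboolP[y Ty <-] := lJ k.
apply/asboolP; exists (lq k i y); first exact: torsion_map.
by rewrite (lqP k).1.
Qed.

Lemma lc_ann_factor (n : nat) (A : lmodType R)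
    (B : 'I_n -> lmodType R) (p : forall k, {linear A -> B k})
    (q : forall k, {linear B k -> A}) i r :
  (forall x, \sum_k q k (p k x) = x) ->
  (forall k, lc_ann m i (B k) r) -> lc_ann m i A r.
Proof.
move=> qp lB; have [I _] := injective_resolution_exists A.
by exists I; apply: ann_local_cohomology_factor qp lB.
Qed.

Lemma lc_ann_summand (A B : lmodType R) (p : {linear A -> B})
    (q : {linear B -> A}) i r :
  (forall x, q (p x) = x) -> lc_ann m i B r -> lc_ann m i A r.
Proof.
move=> qp lB; apply: (@lc_ann_factor 1 A (fun=> B) (fun=> p) (fun=> q)) => //.
by move=> x; rewrite big_ord1.
Qed.

(** The case of an empty family. *)
Lemma lc_ann_trivial N i r : (forall x : N, x = 0) -> lc_ann m i N r.
Proof.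
move=> N0; apply: (@lc_ann_factor 0 N (fun=> N) (fun=> idfun) (fun=> idfun)).
  by move=> x; rewrite big_ord0 [RHS]N0.
by case.
Qed.

(** Independence of the resolution: the case of one module and the identity. *)
Lemma ann_lc_ann N (I : injective_resolution N) i r :
  lc_ann m i N r -> ann (local_cohomology m I i) r.
Proof.
move=> lN; apply: (@ann_local_cohomology_factor 1 N (fun=> N) (fun=> idfun)
  (fun=> idfun)) => //.
by move=> x; rewrite big_ord1.
Qed.

Lemma lc_ann0 N i : lc_ann m i N 0.
Proof.
have [I _] := injective_resolution_exists N.
by exists I => x; rewrite scale0r.
Qed.

Lemma lc_annD N i r s : lc_ann m i N r -> lc_ann m i N s -> lc_ann m i N (r + s).
Proof.
move=> [I Ir] /(@ann_lc_ann N I) Is; exists I => x.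
by rewrite scalerDl Ir Is addr0.
Qed.

Lemma lc_annM N i a r : lc_ann m i N r -> lc_ann m i N (a * r).
Proof. by move=> [I Ir]; exists I => x; rewrite -scalerA Ir scaler0. Qed.

End LocalCohomologyAnnihilator.

(** * Krull dimension *)

Local Open Scope classical_set_scope.

Section Dimension.
Variable R : comNzRingType.
Implicit Types (J K : set R) (P : prime_idealr R) (N V : lmodType R).

(** A set of natural numbers has a supremum in the extended integers: its
    maximum if it is bounded, and +oo if not. *)
Lemma dim_quot_leP J (s : \bar int) : (dim_quot J <= s)%E <->
  forall k, prime_chain J k -> (k%:Z%:E <= s)%E.
Proof.
rewrite /dim_quot; set A := (X in supremum _ X).
have [A0|/existsNP[x0 /not_implyP[Ax0 _]]] := pselect (forall x, A x -> False).
  have -> : A = set0 by rewrite predeqE => x; split=> // /A0.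
  rewrite supremum0 leNye; split=> // _ k kJ.
  by case: (A0 k%:Z%:E); exists k.
have AS : supremums A !=set0.
  have [[b hb]|nb] := pselect (exists b, forall k, prime_chain J k -> (k <= b)%N).
    have ex : exists k, `[< prime_chain J k >].
      by have [k hk _] := Ax0; exists k; apply/asboolP.
    have hb' k : `[< prime_chain J k >] -> (k <= b)%N by move/asboolP; exact: hb.
    have := ex_maxnP ex hb'; case=> n /asboolP hn nmax.
    exists n%:Z%:E; split; last by move=> y; apply; exists n.
    move=> _ [k hk <-]; rewrite lee_fin lez_nat; apply: nmax; exact/asboolP.
  exists +oo%E; split=> [y _|y yA]; first exact: leey.
  case: y yA => [z|//|] yA.
  - exfalso; apply: nb; exists `|z|%N => k kJ.
    have := yA k%:Z%:E (ex_intro2 _ _ k kJ erefl); rewrite lee_fin => kz.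
    by rewrite -lez_nat (le_trans kz) // abszE ler_norm.
  - by have := yA _ Ax0; have [k _ <-] := Ax0.
have A0' : A != set0 by apply/set0P; exists x0.
rewrite /supremum (negPf A0'); have [ub lub] := @xgetPex _ -oo%E (supremums A) AS.
split=> [xs k kJ|H]; last by apply: lub => _ [k kJ <-]; exact: H.
by apply: le_trans xs; apply: ub; exists k.
Qed.

(** If every prime over J lies over some K i, then V(J) is contained in the
    union of the V(K i). *)
Lemma dim_quot_cover (T : Type) J (K : T -> set R) (s : \bar int) :
  (forall P, (forall x, J x -> x \in P) -> exists i, forall x, K i x -> x \in P) ->
  (forall i, (dim_quot (K i) <= s)%E) -> (dim_quot J <= s)%E.
Proof.
move=> cov Ks; apply/dim_quot_leP => k [P [JP Pk]].
by have [i KP] := cov _ JP; apply: (dim_quot_leP _ _).1 (Ks i) _ _; exists P.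
Qed.

Lemma prime_mul_subset P J K : (forall x y, J x -> K y -> x * y \in P) ->
  (forall x, J x -> x \in P) \/ (forall x, K x -> x \in P).
Proof.
move=> JK; have [JP|/existsNP[x /not_implyP[Jx xP]]] :=
  pselect (forall x, J x -> x \in P); [by left|right => y Ky].
by have := JK _ _ Jx Ky; rewrite prime_idealrM => /orP[].
Qed.

Lemma dim_trivial N : (forall x : N, x = 0) -> dim N = -oo%E.
Proof.
move=> N0; apply/eqP; rewrite -leeNy_eq; apply/dim_quot_leP => k [P [NP _]].
by have := NP 1 (fun x => etrans (N0 _) (esym (N0 _))); rewrite idealr1.
Qed.

Lemma dim_le_of_ann N V : (forall r, ann N r -> ann V r) -> (dim V <= dim N)%E.
Proof.
move=> NV; apply: (@dim_quot_cover unit _ (fun=> ann N)) => // P VP.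
by exists tt => x /NV; exact: VP.
Qed.

(** A prime over the annihilator of N lies over that of V or that of V'. *)
Lemma dim_le_of_ann_mul N V V' (s : \bar int) :
  (forall r r', ann V r -> ann V' r' -> ann N (r * r')) ->
  (dim V <= s)%E -> (dim V' <= s)%E -> (dim N <= s)%E.
Proof.
move=> h Vs V's.
apply: (@dim_quot_cover bool _ (fun b => if b then ann V else ann V')).
  move=> P NP; have [|VP|V'P] := @prime_mul_subset P (ann V) (ann V').
  - by move=> x y Vx V'y; exact/NP/h.
  - by exists true.
  - by exists false.
by case.
Qed.

Lemma ann_submod V (S : submodClosed V) r :
  ann (submod S) r <-> forall x, x \in S -> r *: x = 0.
Proof.
split=> [H x Sx|H x]; last by apply: val_inj; apply: H; exact: valP.
by have /(congr1 val) := H (Sub x Sx).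
Qed.

Lemma dim_submod_image V N (f : {linear V -> N}) (S : submodClosed V)
    (T : submodClosed N) :
  (forall y, y \in T -> exists2 x, x \in S & f x = y) ->
  (dim (submod T) <= dim (submod S))%E.
Proof.
move=> ST; apply: dim_le_of_ann => r /ann_submod Sr; apply/ann_submod => y.
by move=> /ST[x Sx <-]; rewrite -linearZ Sr //= linear0.
Qed.

Lemma dim_submod_le V (S T : submodClosed V) : {subset T <= S} ->
  (dim (submod T) <= dim (submod S))%E.
Proof.
move=> TS; apply: (@dim_submod_image _ _ idfun).
by move=> y Ty; exists y => //; exact: TS.
Qed.

Lemma dim_submod_add V (S S' T : submodClosed V) (s : \bar int) :
  (forall z, z \in T -> exists x y, [/\ x \in S, y \in S' & z = x + y]) ->
  (dim (submod S) <= s)%E -> (dim (submod S') <= s)%E ->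
  (dim (submod T) <= s)%E.
Proof.
move=> TSS'; apply: dim_le_of_ann_mul => r r' /ann_submod Sr /ann_submod S'r.
apply/ann_submod => z /TSS'[x [y [Sx S'y ->]]].
by rewrite scalerDr -[in X in _ + X]scalerA (S'r _ S'y) mulrC -scalerA Sr //
  !scaler0 addr0.
Qed.

Lemma dim_subquot_le V (A B : submodClosed V) :
  (dim (subquot A B) <= dim (submod A))%E.
Proof.
apply: dim_le_of_ann => r /ann_submod Ar; apply/ann_subquot => x Ax.
by rewrite Ar // rpred0.
Qed.

Lemma dim_subquot_extension V (A B : submodClosed V) (s : \bar int) :
  (dim (submod B) <= s)%E -> (dim (subquot A B) <= s)%E ->
  (dim (submod A) <= s)%E.
Proof.
apply: dim_le_of_ann_mul => r r' /ann_submod Br /ann_subquot Ar.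
by apply/ann_submod => x Ax; rewrite -scalerA Br // Ar.
Qed.

Lemma subquot_trivial V (A B : submodClosed V) :
  {subset A <= B} -> forall z : subquot A B, z = 0.
Proof.
move=> AB z; have [x <-] := subquot_pi_surj z.
by apply/subquot_pi0/AB/valP.
Qed.

End Dimension.

(** * Noetherian modules *)

Section Noetherian.
Variable R : comNzRingType.
Implicit Types (N V : lmodType R).

Definition ascending_chain_condition N : Prop :=
  forall S : nat -> submodClosed N, (forall k, {subset S k <= S k.+1}) ->
  exists n, forall k, {subset S k <= S n}.

Lemma chain_mono N (S : nat -> submodClosed N) :
  (forall k, {subset S k <= S k.+1}) ->
  forall i j, (i <= j)%N -> {subset S i <= S j}.
Proof.
move=> mS i j /subnK<-; elim: (j - i)%N => [|k IH] x Sx //.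
by rewrite addSn; apply/mS/IH.
Qed.

(** The union of the chain is generated by finitely many elements, which already
    lie in one member. *)
Lemma noetherian_ideal_acc : noetherian R -> ascending_chain_condition R^o.
Proof.
move=> nR S mS; have Smono := chain_mono mS.
have [||| J hJ] := @submodule_of_set R R^o (fun x => exists k, x \in S k).
- by exists 0%N; exact: rpred0.
- move=> x y [i Sx] [j Sy]; exists (maxn i j).
  apply: rpredD; first by apply: Smono Sx; exact: leq_maxl.
  by apply: Smono Sy; exact: leq_maxr.
- by move=> a x [k Sx]; exists k; rewrite rpredZ.
have [n [g hg]] := nR J.
have ex i : exists k, val (g i) \in S k by apply/hJ/valP.
have [b hb] := choice ex.
exists (\max_i b i)%N => k x Sx.
have Jx : x \in J by apply/hJ; exists k.
have [c xc] := hg (Sub x Jx).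
have -> : x = \sum_i c i *: val (g i).
  have := congr1 val xc; rewrite SubK => ->.
  rewrite (raddf_sum (val : {additive submod J -> R^o})).
  by apply: eq_bigr.
apply: rpred_sum => i _; apply: rpredZ; apply: (Smono (b i)) => //.
exact: leq_bigmax.
Qed.

(** Induction on the number of generators: a chain S_k is controlled by the
    ideals of coefficients of the first generator and by the intersections with
    the span T of the others. *)
Lemma fin_gen_acc N : noetherian R -> fin_gen N -> ascending_chain_condition N.
Proof.
move=> nR [n [g hg]] S mS.
suff: forall n (g : 'I_n -> N) (S : nat -> submodClosed N),
    (forall k, {subset S k <= S k.+1}) ->
    (forall k x, x \in S k -> exists c : 'I_n -> R, x = \sum_i c i *: g i) ->
    exists n0, forall k, {subset S k <= S n0}.
  by move/(_ n g S); apply.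
move=> {n g hg S mS}; elim=> [|n IH] g S mS gS.
  exists 0%N => k x /gS[c ->]; rewrite big_ord0; exact: rpred0.
have Smono := chain_mono mS.
pose T x := exists c : 'I_n -> R, x = \sum_i c i *: g (lift ord0 i).
have T0 : T 0 by exists (fun=> 0); rewrite big1 // => i _; rewrite scale0r.
have TD x y : T x -> T y -> T (x + y).
  move=> [c ->] [d ->]; exists (fun i => c i + d i).
  by rewrite -big_split; apply: eq_bigr => i _; rewrite scalerDl.
have TZ a x : T x -> T (a *: x).
  move=> [c ->]; exists (fun i => a * c i).
  by rewrite scaler_sumr; apply: eq_bigr => i _; rewrite scalerA.
have exS' k : exists S' : submodClosed N, forall x, x \in S' <-> x \in S k /\ T x.
  apply: submodule_of_set.
  - by split=> //; exact: rpred0.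
  - by move=> x y [Sx Tx] [Sy Ty]; split; [exact: rpredD|exact: TD].
  - by move=> a x [Sx Tx]; split; [exact: rpredZ|exact: TZ].
have [S' hS'] := choice exS'.
have exJ k : exists J : submodClosed R^o,
    forall a, a \in J <-> exists2 y, T y & a *: g ord0 + y \in S k.
  apply: submodule_of_set.
  - by exists 0 => //; rewrite scale0r addr0 rpred0.
  - move=> a b [y Ty Sy] [z Tz Sz]; exists (y + z); first exact: TD.
    by rewrite scalerDl addrACA rpredD.
  - move=> b a [y Ty Sy]; exists (b *: y); first exact: TZ.
    by rewrite -scalerA -scalerDr rpredZ.
have [J hJ] := choice exJ.
have [k1 h1] : exists n0, forall k, {subset S' k <= S' n0}.
  apply: (IH (fun i => g (lift ord0 i))) => k x /hS'[Sx Tx] //.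
  by apply/hS'; split=> //; exact: mS.
have [k2 h2] : exists n0, forall k, {subset J k <= J n0}.
  apply: noetherian_ideal_acc => // k a /hJ[y Ty Sy].
  by apply/hJ; exists y => //; exact: mS.
exists (maxn k1 k2) => k x Sx.
have [c xc] := gS _ _ Sx; rewrite big_ord_recl in xc.
set y := (X in _ + X) in xc.
have Ty : T y by exists (fun i => c (lift ord0 i)).
have /h2/hJ[z Tz Sz] : c ord0 \in J k by apply/hJ; exists y => //; rewrite -xc.
have Sz' : c ord0 *: g ord0 + z \in S (maxn k1 k2).
  by apply: Smono Sz; exact: leq_maxr.
have : y - z \in S' (maxn k k2).
  apply/hS'; split; last by apply: TD => //; rewrite -scaleN1r; exact: TZ.
  have -> : y - z = x - (c ord0 *: g ord0 + z).
    by rewrite xc opprD addrACA subrr add0r.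
  apply: submodB; first by apply: Smono Sx; exact: leq_maxl.
  by apply: Smono Sz; exact: leq_maxr.
move=> /h1/hS'[Syz _].
have -> : x = (c ord0 *: g ord0 + z) + (y - z).
  by rewrite addrACA subrr addr0.
by rewrite rpredD //; apply: Smono Syz; exact: leq_maxl.
Qed.

Lemma acc_maximal N (F : submodClosed N -> Prop) S0 :
  ascending_chain_condition N -> F S0 ->
  exists S, F S /\ forall T, F T -> {subset S <= T} -> {subset T <= S}.
Proof.
move=> accN FS0; apply: contrapT => nmax.
pose T (i : nat) := {S | F S}.
have [|s [_ hs]] := @dependent_choice_family T (fun i S T =>
    {subset sval S <= sval T} /\ ~ {subset sval T <= sval S}) (exist _ S0 FS0).
  move=> i [S FS]; apply: contrapT => nT; apply: nmax; exists S; split=> // U FU SU.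
  by apply: contrapT => nUS; apply: nT; exists (exist _ U FU).
have [n hn] := accN (fun i => sval (s i)) (fun i => (hs i).1).
exact: (hs n).2 (hn n.+1).
Qed.

End Noetherian.

(** * Largest submodules of bounded dimension *)

Section LargestSubmodule.
Variable R : comNzRingType.
Implicit Types (N : lmodType R) (Q : \bar int -> Prop).

(** A common form for the bounds [< s] and [<= s], given by a set Q of allowed
    dimensions. *)
Definition largest_dim Q N (D : submodClosed N) : Prop :=
  Q (dim (submod D)) /\
  forall E : submodClosed N, Q (dim (submod E)) -> {subset E <= D}.

Definition down_closed Q : Prop := forall s s', (s <= s')%E -> Q s' -> Q s.

Lemma dim_zero_sub N : dim (submod (@zero_sub R N : submodClosed N)) = -oo%E.
Proof.
apply: dim_trivial => x; apply: val_inj.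
by have := valP x; rewrite unfold_in => /eqP.
Qed.

(** A maximal submodule with allowed dimension is the largest one, since the sum
    of two submodules has the dimension of one of them. *)
Lemma largest_dim_exists Q N : ascending_chain_condition N ->
  down_closed Q -> Q -oo%E -> exists D : submodClosed N, largest_dim Q D.
Proof.
move=> accN dQ Q0.
have [|D [QD maxD]] := @acc_maximal R N (fun D => Q (dim (submod D)))
  (@zero_sub R N : submodClosed N) accN; first by rewrite dim_zero_sub.
exists D; split=> // E QE.
have [||| T hT] := @submodule_of_set R N
  (fun z => exists x y, [/\ x \in D, y \in E & z = x + y]).
- by exists 0, 0; rewrite !rpred0 addr0.
- move=> _ _ [x [y [Dx Ey ->]]] [z [w [Dz Ew ->]]]; exists (x + z), (y + w).
  by rewrite !rpredD // addrACA.
- move=> a _ [x [y [Dx Ey ->]]]; exists (a *: x), (a *: y).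
  by rewrite !rpredZ // scalerDr.
have QT : Q (dim (submod T)).
  have := @dim_submod_add R N D E T; rewrite /= => h.
  have hT' z : z \in T -> exists x y, [/\ x \in D, y \in E & z = x + y].
    by move/hT.
  case: (leP (dim (submod D)) (dim (submod E))) => [DE|/ltW ED].
    by apply: dQ QE; apply: h.
  by apply: dQ QD; apply: h.
have DT : {subset D <= T}.
  by move=> x Dx; apply/hT; exists x, 0; rewrite Dx rpred0 addr0.
by move=> y Ey; apply: maxD QT DT _ _; apply/hT; exists 0, y; rewrite rpred0 add0r.
Qed.

(** The image of D under f has at most the dimension of D. *)
Lemma largest_dim_map Q N N' (f : {linear N -> N'}) (D : submodClosed N)
    (D' : submodClosed N') x :
  down_closed Q -> largest_dim Q D -> largest_dim Q D' -> x \in D -> f x \in D'.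
Proof.
move=> dQ [QD _] [_ maxD'] Dx.
apply: (maxD' (im_sub f D : submodClosed N')).
  apply: dQ QD; apply: (@dim_submod_image R N N' f) => y /asboolP[z Dz <-].
  by exists z.
by apply/asboolP; exists x.
Qed.

Lemma down_closed_le (s : \bar int) : down_closed (fun s' => s' <= s)%E.
Proof. by move=> a b ab bs; exact: le_trans bs. Qed.

Lemma down_closed_lt (s : \bar int) : down_closed (fun s' => s' < s)%E.
Proof. by move=> a b ab bs; exact: le_lt_trans bs. Qed.

End LargestSubmodule.

(** * Modules of dimension at most zero over a local ring *)

Section LocalRing.
Variables (R : comNzRingType) (m : idealr R).
Hypotheses (nR : noetherian R) (locR : local_ring m).
Implicit Types (N : lmodType R) (P : prime_idealr R).

(** For a submodule S of [R^o], the closure lemmas for modules do not recognize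
    elements that are typed in R. *)
Lemma ideal0 (S : submodClosed R^o) : (0 : R) \in S.
Proof. exact: (@rpred0 _ S). Qed.

Lemma idealD (S : submodClosed R^o) (x y : R) : x \in S -> y \in S -> x + y \in S.
Proof. exact: (@rpredD _ S). Qed.

Lemma idealM (S : submodClosed R^o) (a x : R) : x \in S -> a * x \in S.
Proof. exact: (@rpredZ _ _ S). Qed.

Lemma ideal_of_submodule (S : submodClosed R^o) : 1 \notin S ->
  exists Q : idealr R, Q =i S.
Proof.
move=> S1; pose p : {pred R} := fun x => x \in S.
have cl : idealr_closed p.
  split; [exact: ideal0|exact: S1|move=> a x y Sx Sy].
  exact: idealD (idealM a Sx) Sy.
pose i := isIdealr.Build R p cl.
by pose Q : idealr R := HB.pack p i; exists Q.
Qed.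

Lemma prime_of_submodule (S : submodClosed R^o) : 1 \notin S ->
  (forall x y : R, x * y \in S -> x \in S \/ y \in S) ->
  exists P : prime_idealr R, P =i S.
Proof.
move=> S1 Sp; pose p : {pred R} := fun x => x \in S.
have cl : idealr_closed p.
  split; [exact: ideal0|exact: S1|move=> a x y Sx Sy].
  exact: idealD (idealM a Sx) Sy.
have pr : prime_idealr_closed p by move=> x y /Sp/orP.
pose i := isIdealr.Build R p cl.
pose j := isPrimeIdealrClosed.Build R p pr.
by pose Q : prime_idealr R := HB.pack p i j; exists Q.
Qed.

Lemma submodule_of_ideal (Q : idealr R) :
  exists S : submodClosed R^o, forall x, x \in S <-> x \in Q.
Proof.
apply: submodule_of_set; first exact: rpred0.
  by move=> x y Qx Qy; exact: rpredD.
by move=> a x Qx; exact: idealMr.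
Qed.

Lemma adjoin_element (S : submodClosed R^o) (a : R) :
  exists T : submodClosed R^o,
    forall x : R, x \in T <-> exists y r : R, y \in S /\ x = y + r * a.
Proof.
apply: submodule_of_set.
- by exists 0, 0; rewrite ideal0 mul0r addr0.
- move=> _ _ [y [r [Sy ->]]] [z [s [Sz ->]]]; exists (y + z), (r + s).
  by rewrite idealD // mulrDl addrACA.
- move=> b _ [y [r [Sy ->]]]; exists (b * y), (b * r).
  by rewrite idealM // -mulrA -mulrDr.
Qed.

Lemma ideal_subset_max (Q : idealr R) : {subset Q <= m}.
Proof.
have [S hS] := submodule_of_ideal Q.
have [|T [[T1 QT] Tmax]] := @acc_maximal R R^o
    (fun T => 1 \notin T /\ {subset Q <= T}) S (noetherian_ideal_acc nR).
  split; last by move=> x; move/hS.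
  by apply/negP => /hS; rewrite idealr1.
have [Q' hQ'] := ideal_of_submodule T1.
have Q'max : maximal_ideal Q'.
  move=> Q'' sub x; apply/idP/idP; last exact: sub.
  have [U hU] := submodule_of_ideal Q''.
  have TU : {subset T <= U} by move=> y; rewrite -hQ' => /sub /hU.
  move=> /hU Ux; rewrite hQ'; apply: (Tmax _ _ TU) Ux; split.
    by apply/negP => /hU; rewrite idealr1.
  by move=> y /QT /TU.
by move=> x /QT; rewrite -hQ' (locR.2 _ Q'max).
Qed.

Lemma prime_over_max P : {subset m <= P} -> P =i m.
Proof. exact: locR.1. Qed.

Lemma max_prime : exists P : prime_idealr R, P =i m.
Proof.
have [S hS] := submodule_of_ideal m.
have [||P hP] := @prime_of_submodule S.
- by apply/negP => /hS; rewrite idealr1.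
- move=> x y /hS xy; apply: contrapT => /not_orP[/negP xS /negP yS].
  have [T hT] := adjoin_element S x.
  have [T1|T1] := boolP ((1 : R^o) \in T); last first.
    have [Q hQ] := ideal_of_submodule T1.
    move/negP: xS; apply; apply/hS/(ideal_subset_max (Q := Q)).
    by rewrite hQ; apply/hT; exists 0, 1; rewrite ideal0 mul1r add0r.
  have [z [r [/hS mz e]]] := (hT _).1 T1.
  move/negP: yS; apply; apply/hS.
  rewrite -[y]mul1r e mulrDl; apply: rpredD.
    by rewrite mulrC idealMr.
  by rewrite -mulrA idealMr.
- by exists P => x; rewrite hP; apply/idP/idP; move/hS.
Qed.

(** A prime strictly below the maximal ideal starts a chain of length one. *)
Lemma dim_le0_prime N P : (dim N <= 0)%E ->
  (forall x, ann N x -> x \in P) -> {subset m <= P}.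
Proof.
move=> d0 NP; apply: contrapT => mP.
have [M hM] := max_prime.
have PM : {subset P <= M} by move=> x Px; rewrite hM (ideal_subset_max Px).
have : prime_chain (ann N) 1.
  exists (fun i => if i is 0%N then P else M); split=> // -[|//] _.
  split=> // MP; apply: mP => x; rewrite -hM; exact: MP.
by move/(dim_quot_leP _ _).1: d0 => h /h.
Qed.

(** The product of the powers k and l contains the power k + l, expressed
    through arbitrary sets that contain them. *)
Lemma ideal_exp_mul (I K J : R -> Prop) k l :
  J 0 -> (forall x y, J x -> J y -> J (x + y)) ->
  (forall x y, I x -> K y -> J (x * y)) ->
  (forall r, ideal_exp [set` m] k r -> I r) ->
  (forall r, ideal_exp [set` m] l r -> K r) ->
  forall r, ideal_exp [set` m] (k + l) r -> J r.
Proof.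
elim: k I J => [|k IH] I J J0 JD IK kI lK r.
  by move=> /lK Kr; rewrite -[r]mul1r; apply: IK => //; exact: kI.
case=> n [a [b [ab ->]]].
apply: (big_ind J) => // i _; have [ai bi] := ab i.
apply: (IH (fun x => I (a i * x)) (fun x => J (a i * x))) bi => //.
- by rewrite mulr0.
- by move=> x y Jx Jy; rewrite mulrDr; exact: JD.
- by move=> x y Ix Ky; rewrite mulrA; exact: IK.
- move=> s sk; apply: kI; exists 1%N, (fun=> a i), (fun=> s).
  by split; [|rewrite big_ord1].
Qed.

(** Noetherian induction: if J is not prime, say a b lies in J with a and b
    outside J, then powers of m lie in J + (a) and in J + (b), and the product
    of these two ideals lies in J. *)
Lemma power_of_max_subset (J : submodClosed R^o) :
  (forall P, (forall x, x \in J -> x \in P) -> {subset m <= P}) ->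
  exists k, forall r, ideal_exp [set` m] k r -> r \in J.
Proof.
pose F (J : submodClosed R^o) :=
  (forall P, (forall x, x \in J -> x \in P) -> {subset m <= P}) /\
  ~ exists k, forall r, ideal_exp [set` m] k r -> r \in J.
move=> hJ; apply: contrapT => nJ.
have [{hJ nJ J}J [[hJ nJ] Jmax]] :=
  @acc_maximal R R^o F J (noetherian_ideal_acc nR) (conj hJ nJ).
have J1 : (1 : R^o) \notin J.
  apply/negP => J1; apply: nJ; exists 0%N => r _.
  by rewrite -[r]mulr1; exact: idealM.
have [a [b [ab aJ bJ]]] : exists a b : R, [/\ a * b \in J, a \notin J & b \notin J].
  apply: contrapT => nab; apply: nJ.
  have [|P hP] := prime_of_submodule J1.
    move=> x y xy; apply: contrapT => /not_orP[/negP xJ /negP yJ].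
    by apply: nab; exists x, y.
  have mP : {subset m <= P} by apply: hJ => x; rewrite hP.
  exists 1%N => _ [n [c [d [cd ->]]]].
  apply: (@rpred_sum _ J) => i _; rewrite mulrC; apply: idealM.
  by rewrite -hP; apply: mP; case: (cd i).
have big c : c \notin J -> exists (T : submodClosed R^o) k,
    (forall x : R, x \in T <-> exists y r : R, y \in J /\ x = y + r * c) /\
    forall r, ideal_exp [set` m] k r -> r \in T.
  move=> cJ; have [T hT] := adjoin_element J c; exists T.
  have JT : {subset J <= T}.
    by move=> x Jx; apply/hT; exists x, 0; rewrite mul0r addr0.
  suff [k hk] : exists k, forall r, ideal_exp [set` m] k r -> r \in T by exists k.
  apply: contrapT => nT; move/negP: cJ; apply.
  have FT : F T by split=> // P TP; apply: hJ => x /JT; exact: TP.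
  apply: (Jmax _ FT JT); apply/hT; exists 0, 1.
  by rewrite ideal0 mul1r add0r.
have [T [k [hT Tk]]] := big a aJ; have [U [l [hU Ul]]] := big b bJ.
apply: nJ; exists (k + l)%N => r.
apply: (ideal_exp_mul (I := fun x => x \in T) (K := fun x => x \in U)
  (J := fun x => x \in J)) => //.
- exact: ideal0.
- by move=> x y Jx Jy; exact: idealD.
- move=> _ _ /hT[y [s [Jy ->]]] /hU[z [t [Jz ->]]].
  rewrite mulrDl; apply: idealD; first by rewrite mulrC; exact: idealM.
  rewrite mulrDr; apply: idealD; first exact: idealM.
  by rewrite mulrACA; exact: idealM.
Qed.

Lemma dim_le0_torsion N (D : submodClosed N) :
  (dim (submod D) <= 0)%E -> {subset D <= @torsion R m N}.
Proof.
move=> d0.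
have [||| J hJ] := @submodule_of_set R R^o (ann (submod D)).
- by move=> x; rewrite scale0r.
- by move=> r s Dr Ds x; rewrite scalerDl Dr Ds addr0.
- by move=> a r Dr x; rewrite -scalerA Dr scaler0.
have [|k hk] := @power_of_max_subset J.
  by move=> P JP; apply: dim_le0_prime d0 _ => x /hJ; exact: JP.
move=> x Dx; apply/asboolP; exists k => r /hk/hJ/ann_submod; exact.
Qed.

(** The torsion submodule is killed by some power of the maximal ideal, by the
    ascending chain condition, so no prime other than m contains its
    annihilator. *)
Lemma dim_torsion N : ascending_chain_condition N ->
  (dim (submod (@torsion R m N : submodClosed N)) <= 0)%E.
Proof.
move=> accN.
have exG k : exists G : submodClosed N, forall x,
    x \in G <-> forall r, ideal_exp [set` m] k r -> r *: x = 0.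
  apply: submodule_of_set.
  - by move=> r _; rewrite scaler0.
  - by move=> x y kx ky r rk; rewrite scalerDr kx // ky // addr0.
  - by move=> a x kx r rk; rewrite scalerA mulrC -scalerA kx // scaler0.
have [G hG] := choice exG.
have [|n hn] := accN G.
  move=> k x /hG kx; apply/hG => _ [l [a [b [ab ->]]]].
  rewrite scaler_suml big1 // => i _; have [_ bi] := ab i.
  by rewrite -scalerA kx // scaler0.
have tn r : ideal_exp [set` m] n r -> ann (submod (@torsion R m N : submodClosed N)) r.
  move=> rn; apply/ann_submod => x /asboolP[k /hG kx].
  by have /hG := hn _ _ kx; apply.
apply/dim_quot_leP => -[|k] // [P [nP /(_ 0%N isT)[P01 P10]]].
exfalso; apply: P10.
have mP0 : {subset m <= P 0%N}.
  move=> x mx; have : x ^+ n \in P 0%N.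
    apply/nP/tn; elim: (n) => [|j IH] //; exists 1%N, (fun=> x), (fun=> x ^+ j).
    by rewrite big_ord1 exprS.
  elim: (n) => [|j IH]; first by rewrite expr0 idealr1.
  by rewrite exprS prime_idealrM => /orP[].
move=> x; rewrite (@prime_over_max (P 1%N)); first exact: mP0.
by move=> y /mP0/P01.
Qed.

End LocalRing.

(** * Maps between subquotients *)

Section SubquotientMap.
Variables (R : comNzRingType) (V V' : lmodType R).
Variables (A B : submodClosed V) (A' B' : submodClosed V').
Variable f : {linear V -> V'}.
Hypotheses (fA : forall x, x \in A -> f x \in A').
Hypotheses (fB : forall x, x \in B -> f x \in B').

Lemma subquot_map : exists g : {linear subquot A B -> subquot A' B'},
  forall x x', val x' = f (val x) -> g (subquot_pi B x) = subquot_pi B' x'.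
Proof.
have exF (x : submod A) : exists x' : submod A', val x' = f (val x).
  by exists (Sub (f (val x)) (fA (valP x))).
have [F hF] := choice exF.
have [r hr] := choice (@subquot_pi_surj R V A B).
have valE (W : lmodType R) (C : submodClosed W) b (x y : submod C) :
    val (b *: x + y) = b *: val x + val y by rewrite linearD linearZ.
have piE (W : lmodType R) (C C' : submodClosed W) (x y : submod C) :
    subquot_pi C' x = subquot_pi C' y <-> val x - val y \in C'.
  have <- : val (-1 *: y + x) = val x - val y.
    by rewrite linearD linearZ /= scaleN1r addrC.
  rewrite -subquot_pi0 subquot_pi_linear scaleN1r addrC.
  by rewrite (rwP eqP) [X in _ <-> X](rwP eqP) subr_eq0.
have FE x y : subquot_pi B x = subquot_pi B y ->
    subquot_pi B' (F x) = subquot_pi B' (F y).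
  by move=> /piE xy; apply/piE; rewrite !hF -linearB fB.
have [|g hg] := @linear_of_function R (subquot A B) (subquot A' B')
    (fun z => subquot_pi B' (F (r z))).
  move=> a x y; rewrite -subquot_pi_linear.
  have -> : subquot_pi B' (F (r (a *: x + y))) =
      subquot_pi B' (F (a *: r x + r y)).
    by apply: FE; rewrite subquot_pi_linear !hr.
  congr (subquot_pi B' _); apply: val_inj.
  by rewrite hF !valE linearD linearZ !hF.
exists g => x x' xx'; rewrite hg -[RHS](_ : subquot_pi B' (F x) = _).
  by apply: FE; rewrite hr.
by apply/piE; rewrite hF xx' subrr rpred0.
Qed.

End SubquotientMap.

(** * One-Cohen-Macaulay modules *)

Section OneCohenMacaulay.
Variables (R : comNzRingType) (m : idealr R).
Implicit Types (N X Y : lmodType R) (P : prime_idealr R).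

Lemma prime_ideal_prod P d (L : 'I_d -> set R) :
  (forall x, (\big[@ideal_mul R/setT]_(j < d) L j) x -> x \in P) ->
  exists j, forall x, L j x -> x \in P.
Proof.
elim: d L => [|d IH] L; first by rewrite big_ord0 => /(_ 1 I); rewrite idealr1.
rewrite big_ord_recl => H.
have [|h|/IH[j h]] := @prime_mul_subset R P (L ord0)
    (\big[@ideal_mul R/setT]_(j < d) L (lift ord0 j)).
- move=> x y Lx Ly; apply: H; exists 1%N, (fun=> x), (fun=> y).
  by split; [|rewrite big_ord1].
- by exists ord0.
- by exists (lift ord0 j).
Qed.

Lemma ideal_prod_subset d (L : 'I_d -> set R) j x :
  (forall j, L j 0) -> (forall j x y, L j x -> L j y -> L j (x + y)) ->
  (forall j a x, L j x -> L j (a * x)) ->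
  (\big[@ideal_mul R/setT]_(j < d) L j) x -> L j x.
Proof.
elim: d L j x => [|d IH] L j x L0 LD LM; first by case: j.
rewrite big_ord_recl => -[n [a [b [ab ->]]]].
apply: (big_ind (L j)) => // [y z|i _]; first exact: LD.
have [ai bi] := ab i; case: (unliftP ord0 j) => [j' ->|->].
  apply: (LM); exact: (IH (fun j => L (lift ord0 j)) j' (b i) (fun=> L0 _)
    (fun=> LD _) (fun=> LM _) bi).
by rewrite mulrC; apply: LM.
Qed.

(** The product is contained in each of its factors, as these are ideals. *)
Lemma lc_ann_prod_prime N P :
  (forall x, lc_ann_prod m N x -> x \in P) <->
  exists j, (j < `|fine (dim N)|)%N /\ forall x, lc_ann m j N x -> x \in P.
Proof.
split=> [/prime_ideal_prod[j h]|[j [jd h]] x]; first by exists j.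
move=> /(@ideal_prod_subset _ _ (Ordinal jd) x) H; apply: h; apply: H => *.
- exact: lc_ann0.
- exact: lc_annD.
- exact: lc_annM.
Qed.

Lemma dim_ge0 N : dim N = -oo%E \/ (0 <= dim N)%E.
Proof.
have [[k hk]|nk] := pselect (exists k, prime_chain (ann N) k).
  right; apply: (@le_trans _ _ k%:Z%:E%E); first by rewrite lee_fin.
  by apply: (dim_quot_leP _ _).1 hk; exact: lexx.
left; apply/eqP; rewrite -leeNy_eq; apply/dim_quot_leP => k hk.
by case: nk; exists k.
Qed.

Lemma one_cohen_macaulay_dim_le0 N : (dim N <= 0)%E -> one_cohen_macaulay m N.
Proof.
move=> d0; rewrite /one_cohen_macaulay /lc_ann_prod.
have -> : `|fine (dim N)|%N = 0%N.
  by have [->|d0'] := dim_ge0 N => //; have -> : dim N = 0%E by apply/le_anti/andP.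
rewrite big_ord0; apply/dim_quot_leP => k [P [h _]].
by have := h 1 I; rewrite idealr1.
Qed.

(** If X and Y have the same dimension, their products have the same number of
    factors; a summand has larger annihilators. *)
Lemma one_cohen_macaulay_summand (s : \bar int) X Y
    (p : {linear Y -> X}) (q : {linear X -> Y}) :
  (forall y, q (p y) = y) ->
  (forall x : X, x = 0) \/ dim X = s -> (forall y : Y, y = 0) \/ dim Y = s ->
  one_cohen_macaulay m X -> one_cohen_macaulay m Y.
Proof.
move=> qp Xs Ys cmX; case: Ys => [Y0|Ys].
  by apply: one_cohen_macaulay_dim_le0; rewrite (dim_trivial Y0).
case: Xs => [X0|Xs].
  apply: one_cohen_macaulay_dim_le0; rewrite dim_trivial // => y.
  by rewrite -[y]qp (X0 (p y)) linear0.
apply: (@dim_quot_cover R unit _ (fun=> lc_ann_prod m X)) => // P.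
move=> /lc_ann_prod_prime[j [jd h]]; exists tt; apply/lc_ann_prod_prime.
exists j; split; first by rewrite Xs -Ys.
by move=> x Xx; apply: h; exact: (lc_ann_summand qp Xx).
Qed.

(** A prime over the annihilator of the cohomology of X lies over one of the
    annihilators for the summands, since it lies over their intersection. *)
Lemma one_cohen_macaulay_sum (s : \bar int) n X (Y : 'I_n -> lmodType R)
    (p : forall k, {linear X -> Y k}) (q : forall k, {linear Y k -> X}) :
  (forall x, \sum_k q k (p k x) = x) ->
  (forall x : X, x = 0) \/ dim X = s ->
  (forall k, (forall y : Y k, y = 0) \/ dim (Y k) = s) ->
  (forall k, one_cohen_macaulay m (Y k)) -> one_cohen_macaulay m X.
Proof.
move=> qp Xs Ys cmY; case: Xs => [X0|Xs].
  by apply: one_cohen_macaulay_dim_le0; rewrite (dim_trivial X0).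
apply: (@dim_quot_cover R 'I_n _ (fun k => lc_ann_prod m (Y k))) => // P.
move=> /lc_ann_prod_prime[j [jd h]].
have [k hk] : exists k, forall x, lc_ann m j (Y k) x -> x \in P.
  apply: contrapT => nk.
  have ex k : exists x, lc_ann m j (Y k) x /\ x \notin P.
    apply: contrapT => nx; apply: nk; exists k => x kx; apply: contrapT => /negP xP.
    by apply: nx; exists x.
  have [r hr] := choice ex.
  have : \prod_k r k \in P.
    apply/h/(lc_ann_factor qp) => k; rewrite (bigD1 k) //= mulrC.
    by apply: lc_annM; exact: (hr k).1.
  apply/negP; apply: (big_ind (fun x => x \notin P)); first by rewrite idealr1.
    by move=> x y xP yP; rewrite prime_idealrM negb_or xP.
  by move=> k _; exact: (hr k).2.
exists k; apply/lc_ann_prod_prime; exists j; split=> //.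
have [Yk0|->] := Ys k; last by rewrite -Xs.
by have := hk 1 (lc_ann_trivial m j 1 Yk0); rewrite idealr1.
Qed.

End OneCohenMacaulay.

(** * Layers of given dimension *)

Section Layers.
Variables (R : comNzRingType) (m : idealr R).
Implicit Types (N : lmodType R) (s : \bar int).

(** A / B is the graded piece in dimension s of the dimension filtration. *)
Definition dim_layer N s (A B : submodClosed N) : Prop :=
  largest_dim (fun s' => s' <= s)%E A /\ largest_dim (fun s' => s' < s)%E B.

Lemma dim_layer_exists N s : ascending_chain_condition N -> (-oo < s)%E ->
  exists AB : submodClosed N * submodClosed N, dim_layer s AB.1 AB.2.
Proof.
move=> accN s0.
have [A hA] := largest_dim_exists accN (@down_closed_le s) (leNye s).
have [B hB] := largest_dim_exists accN (@down_closed_lt s) s0.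
by exists (A, B).
Qed.

Lemma dim_layer_gt N s (A B : submodClosed N) : dim_layer s A B -> (-oo < s)%E.
Proof. by move=> [_ [Bs _]]; apply: le_lt_trans Bs; exact: leNye. Qed.

(** If dim A < s, then A is contained in B; otherwise dim A = s > dim B. *)
Lemma dim_layer_subquot N s (A B : submodClosed N) : dim_layer s A B ->
  (forall x : subquot A B, x = 0) \/ dim (subquot A B) = s.
Proof.
move=> [[As _] [Bs maxB]].
have [/maxB AB|sA] := ltP (dim (submod A)) s.
  by left; exact: subquot_trivial.
right; have eA : dim (submod A) = s by apply/le_anti/andP.
apply/le_anti/andP; split; first by rewrite -eA dim_subquot_le.
rewrite leNgt; apply/negP => ABs.
have [h|/ltW h] := leP (dim (subquot A B)) (dim (submod B)).
  by have := dim_subquot_extension (lexx _) h; rewrite eA leNgt Bs.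
by have := dim_subquot_extension h (lexx _); rewrite eA leNgt ABs.
Qed.

Lemma dim_layer_map N (N' : lmodType R) s (A B : submodClosed N)
    (A' B' : submodClosed N')
    (f : {linear N -> N'}) : dim_layer s A B -> dim_layer s A' B' ->
  exists g : {linear subquot A B -> subquot A' B'},
    forall x x', val x' = f (val x) -> g (subquot_pi B x) = subquot_pi B' x'.
Proof.
move=> [hA hB] [hA' hB']; apply: subquot_map => x.
  exact: largest_dim_map (@down_closed_le s) hA hA'.
exact: largest_dim_map (@down_closed_lt s) hB hB'.
Qed.

Lemma dim_layer_mem N (N' : lmodType R) s (A B : submodClosed N)
    (A' B' : submodClosed N')
    (f : {linear N -> N'}) x : dim_layer s A B -> dim_layer s A' B' ->
  x \in A -> f x \in A'.
Proof.
move=> [hA _] [hA' _]; exact: largest_dim_map (@down_closed_le s) hA hA'.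
Qed.

Lemma dim_layer_summand N (N' : lmodType R) s (A B : submodClosed N)
    (A' B' : submodClosed N')
    (p : {linear N' -> N}) (q : {linear N -> N'}) :
  (forall x, q (p x) = x) -> dim_layer s A B -> dim_layer s A' B' ->
  one_cohen_macaulay m (subquot A B) -> one_cohen_macaulay m (subquot A' B').
Proof.
move=> qp hAB hAB'.
have [p' hp'] := dim_layer_map p hAB' hAB.
have [q' hq'] := dim_layer_map q hAB hAB'.
apply: (@one_cohen_macaulay_summand R m s _ _ p' q') => [z||].
- have [x <-] := subquot_pi_surj z.
  have [y hy] : exists y : submod A, val y = p (val x).
    by exists (Sub (p (val x)) (dim_layer_mem p hAB' hAB (valP x))).
  by rewrite (hp' x y hy); apply: hq'; rewrite hy qp.
- exact: dim_layer_subquot.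
- exact: dim_layer_subquot.
Qed.

Lemma dim_layer_sum n N (N' : 'I_n -> lmodType R) s (A B : submodClosed N)
    (A' B' : forall k, submodClosed (N' k))
    (p : forall k, {linear N -> N' k}) (q : forall k, {linear N' k -> N}) :
  (forall x, \sum_k q k (p k x) = x) -> dim_layer s A B ->
  (forall k, dim_layer s (A' k) (B' k)) ->
  (forall k, one_cohen_macaulay m (subquot (A' k) (B' k))) ->
  one_cohen_macaulay m (subquot A B).
Proof.
move=> qp hAB hAB'.
pose p' k := projT1 (cid (dim_layer_map (p k) hAB (hAB' k))).
have hp' k : forall x x', val x' = p k (val x) ->
    p' k (subquot_pi B x) = subquot_pi (B' k) x'.
  exact: projT2 (cid (dim_layer_map (p k) hAB (hAB' k))).
pose q' k := projT1 (cid (dim_layer_map (q k) (hAB' k) hAB)).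
have hq' k : forall x x', val x' = q k (val x) ->
    q' k (subquot_pi (B' k) x) = subquot_pi B x'.
  exact: projT2 (cid (dim_layer_map (q k) (hAB' k) hAB)).
apply: (@one_cohen_macaulay_sum R m s n _ _ p' q') => [z||].
- have [x <-] := subquot_pi_surj z.
  pose y k : submod (A' k) :=
    Sub (p k (val x)) (dim_layer_mem (p k) hAB (hAB' k) (valP x)).
  pose w k : submod A :=
    Sub (q k (val (y k))) (dim_layer_mem (q k) (hAB' k) hAB (valP (y k))).
  have -> : \sum_k q' k (p' k (subquot_pi B x)) = \sum_k subquot_pi B (w k).
    by apply: eq_bigr => k _; rewrite (hp' k x (y k)) // (hq' k _ (w k)).
  have [pi hpi] := linear_of_function (@subquot_pi_linear R N A B).
  under eq_bigr do rewrite -hpi.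
  rewrite -linear_sum hpi; congr (subquot_pi B _); apply: val_inj.
  rewrite (raddf_sum (val : {additive submod A -> N})) -[RHS]qp.
  by apply: eq_bigr.
- exact: dim_layer_subquot.
- by move=> k; exact: dim_layer_subquot.
Qed.

End Layers.

(** * The dimension filtration *)

Section DimensionFiltration.
Variables (R : comNzRingType) (m : idealr R).
Hypotheses (nR : noetherian R) (locR : local_ring m).
Variable N : lmodType R.
Hypothesis accN : ascending_chain_condition N.
Implicit Types (D : nat -> submodClosed N) (A B : submodClosed N).

Local Notation torsionN := (@torsion R m N : submodClosed N).

(** D_i is also the largest submodule of dimension at most dim D_i, because
    dim D_{i+1} < dim D_i. *)
Lemma dimension_filtration_layer t D i : dimension_filtration m t D ->
  (i < t)%N -> dim_layer (dim (submod (D i))) (D i) (D i.+1).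
Proof.
move=> [D0 Dt Ddec Dlt] it; split; last exact: Dlt.
split=> //; case: i it => [_ E _ x _|i it E ED]; first by rewrite D0.
have [Di maxDi] := Dlt _ (ltnW it); apply: maxDi; exact: le_lt_trans Di.
Qed.

Let smaller_layer A : largest_dim (fun s => s <= dim (submod A))%E A ->
  ~~ (dim (submod A) <= 0)%E ->
  exists A', [/\ largest_dim_lt (dim (submod A)) A',
    largest_dim (fun s => s <= dim (submod A'))%E A', {subset A' <= A} &
    {subset torsionN <= A'}].
Proof.
move=> [_ maxA]; rewrite -ltNge => A0.
have [|A' [A'A maxA']] :=
  largest_dim_exists accN (@down_closed_lt (dim (submod A))).
  by apply: le_lt_trans A0; exact: leNye.
exists A'; split=> //.
- by split=> // E EA'; apply: maxA'; exact: le_lt_trans A'A.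
- by apply: maxA; exact: ltW.
- by apply: maxA'; apply: le_lt_trans A0; apply: dim_torsion.
Qed.

(* The tail of a dimension filtration that starts at A. *)
Let chain_from A : Prop := exists t D, [/\ D 0%N = A, D t =i torsionN,
  forall i, (i < t)%N -> {subset D i.+1 <= D i} &
  forall i, (i < t)%N -> largest_dim_lt (dim (submod (D i))) (D i.+1)].

Let chain_from_le0 A : (dim (submod A) <= 0)%E -> {subset torsionN <= A} ->
  chain_from A.
Proof.
move=> A0 TA; exists 0%N, (fun=> A); split=> // x; apply/idP/idP; last exact: TA.
exact: (dim_le0_torsion nR locR A0).
Qed.

Let chain_from_cons A A' : largest_dim_lt (dim (submod A)) A' ->
  {subset A' <= A} -> chain_from A' -> chain_from A.
Proof.
move=> hA' A'A [t [D [D0 Dt Ddec Dlt]]].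
exists t.+1, (fun i => if i is j.+1 then D j else A); split=> //.
  by move=> [|i] it; [rewrite D0|exact: Ddec].
by move=> [|i] it; [rewrite D0|exact: Dlt].
Qed.

(** Dimensions lie in the well-order -oo < 0 < 1 < ... < +oo, so taking the
    largest submodule of smaller dimension stops, also when dim A = +oo. *)
Let chain_from_exists A : largest_dim (fun s => s <= dim (submod A))%E A ->
  {subset torsionN <= A} -> chain_from A.
Proof.
have fin n : forall A, (dim (submod A) <= n%:Z%:E)%E ->
    largest_dim (fun s => s <= dim (submod A))%E A ->
    {subset torsionN <= A} -> chain_from A.
  elim: n => [|n IH] {}A An hA TA; first exact: chain_from_le0.
  have [A0|A0] := boolP (dim (submod A) <= 0)%E; first exact: chain_from_le0.
  have [A' [ltA' hA' A'A TA']] := smaller_layer hA A0.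
  apply: (chain_from_cons ltA' A'A); apply: IH hA' TA'.
  have := lt_le_trans ltA'.1 An.
  by case: (dim _) => [z||] //=; rewrite lte_fin lee_fin; lia.
move=> hA TA; have [A0|A0] := boolP (dim (submod A) <= 0)%E.
  exact: chain_from_le0.
have [A' [ltA' hA' A'A TA']] := smaller_layer hA A0.
apply: (chain_from_cons ltA' A'A).
suff [n hn] : exists n : nat, (dim (submod A') <= n%:Z%:E)%E by apply: fin hn _ _.
have := lt_le_trans ltA'.1 (leey _).
case: (dim _) => [z||] // _; last by exists 0%N.
by exists `|z|%N; rewrite lee_fin abszE ler_norm.
Qed.

Lemma dimension_filtration_exists : exists t D, dimension_filtration m t D.
Proof.
have [||| A hA] := @submodule_of_set R N (fun=> True) => //.
have [||t [D [D0 Dt Ddec Dlt]]] := @chain_from_exists A.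
- by split=> // E _ x _; apply/hA.
- by move=> x _; apply/hA.
- by exists t, D; split=> // x; rewrite D0; apply/hA.
Qed.

(** A nonzero layer in dimension s > 0 occurs in the filtration: the last D_i
    that contains A has dimension s. A layer of dimension at most zero is
    1-Cohen-Macaulay because the product of annihilators is empty. *)
Lemma seq_one_cohen_macaulay_layers : seq_one_cohen_macaulay m N <->
  forall s A B, dim_layer s A B -> one_cohen_macaulay m (subquot A B).
Proof.
split=> [[t [D [hD cmD]]] s A B hAB|H]; last first.
  have [t [D hD]] := dimension_filtration_exists; exists t, D; split=> // i it.
  exact: H (dimension_filtration_layer hD it).
have [D0 Dt _ Dlt] := hD; have [[As maxA] [_ maxB]] := hAB.
have [/maxB AB|sA] := ltP (dim (submod A)) s.
  apply: one_cohen_macaulay_dim_le0.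
  by rewrite dim_trivial //; exact: subquot_trivial.
have eA : dim (submod A) = s by apply/le_anti/andP.
have locate j : (j <= t)%N -> {subset A <= D j} \/
    exists i, [/\ (i < t)%N, {subset A <= D i} & ~ {subset A <= D i.+1}].
  elim: j => [_|j IH jt]; first by left=> x _; rewrite D0.
  have [AD|] := IH (ltnW jt); last by right.
  have [|nAD] := pselect {subset A <= D j.+1}; first by left.
  by right; exists j.
have [AT|[i [it AD nAD]]] := locate t (leqnn t).
  apply: one_cohen_macaulay_dim_le0; apply: le_trans (dim_subquot_le A B) _.
  apply: le_trans (dim_torsion locR accN).
  by apply: dim_submod_le => x /AT; rewrite Dt.
have eD : dim (submod (D i)) = s.
  apply/le_anti; rewrite -{2}eA dim_submod_le // andbT leNgt.
  by apply/negP => sD; apply/nAD/(Dlt _ it).2; rewrite eA.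
have hDi := dimension_filtration_layer hD it; rewrite eD in hDi.
exact: (@dim_layer_summand R m N N s _ _ _ _ idfun idfun _ hDi hAB (cmD i it)).
Qed.

End DimensionFiltration.

(** * Direct sums *)

Section DirectSumMaps.
Variables (R : comNzRingType) (n : nat) (M : 'I_n -> lmodType R).

Lemma dsum_proj_exists i : exists p : {linear dsum M -> M i}, forall f, p f = f i.
Proof.
by apply: linear_of_function => a f g; rewrite !ffunE.
Qed.

Lemma dsum_inj_exists i : exists q : {linear M i -> dsum M},
  forall x, q x i = x /\ forall j, j != i -> q x j = 0.
Proof.
have [|q hq] := @linear_of_function R (M i) (dsum M)
    (fun x => [ffun j => dfwith (fun j => 0 : M j) x j]).
  move=> a x y; apply/ffunP => j; rewrite !ffunE.
  have [->|ji] := eqVneq j i; first by rewrite !dfwith_in.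
  by rewrite !dfwith_out 1?eq_sym // scaler0 addr0.
exists q => x; rewrite hq; split=> [|j ji]; rewrite ffunE ?dfwith_in //.
by rewrite dfwith_out // eq_sym.
Qed.

Lemma dsum_biproduct : exists (p : forall i, {linear dsum M -> M i})
    (q : forall i, {linear M i -> dsum M}),
  (forall f, \sum_i q i (p i f) = f) /\ forall i x, p i (q i x) = x.
Proof.
pose p i := projT1 (cid (dsum_proj_exists i)).
have hp i : forall f, p i f = f i by exact: projT2 (cid (dsum_proj_exists i)).
pose q i := projT1 (cid (dsum_inj_exists i)).
have hq i : forall x, q i x i = x /\ forall j, j != i -> q i x j = 0.
  exact: projT2 (cid (dsum_inj_exists i)).
exists p, q; split=> [f|i x]; last by rewrite hp (hq i x).1.
apply/ffunP => j; rewrite -hp linear_sum (bigD1 j) //= big1 => [|i ij].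
  by rewrite !hp (hq j _).1 addr0.
by rewrite hp (hq i _).2 // eq_sym.
Qed.

Lemma fin_gen_dsum : (forall i, fin_gen (M i)) -> fin_gen (dsum M).
Proof.
move=> fgM; have [p [q [qp _]]] := dsum_biproduct.
pose k i := projT1 (cid (fgM i)).
have exg i : exists g : 'I_(k i) -> M i, forall x, exists c : 'I_(k i) -> R,
    x = \sum_j c j *: g j by exact: projT2 (cid (fgM i)).
pose g i := projT1 (cid (exg i)).
have hg i : forall x, exists c : 'I_(k i) -> R, x = \sum_j c j *: g i j.
  exact: projT2 (cid (exg i)).
pose K := {i : 'I_n & 'I_(k i)}.
exists #|{: K}|, (fun u => let v := enum_val u in q (tag v) (g (tag v) (tagged v))).
move=> f; pose c i := projT1 (cid (hg i (p i f))).
have hc i : p i f = \sum_j c i j *: g i j by exact: projT2 (cid (hg i (p i f))).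
exists (fun u => let v := enum_val u in c (tag v) (tagged v)).
rewrite -(big_enum_val (fun v : K =>
  c (tag v) (tagged v) *: q (tag v) (g (tag v) (tagged v)))) /=.
rewrite -[LHS]qp.
have -> : \sum_i q i (p i f) = \sum_i \sum_(j < k i) c i j *: q i (g i j).
  apply: eq_bigr => i _; rewrite {1}hc linear_sum.
  by apply: eq_bigr => j _; rewrite linearZ.
by rewrite sig_big_dep.
Qed.

End DirectSumMaps.

Theorem mainTheorem1 (R : comNzRingType) (m : idealr R) (n : nat)
    (M : 'I_n -> lmodType R) :
  noetherian R -> local_ring m -> (1 <= n)%N ->
  (forall i, fin_gen (M i)) ->
  seq_one_cohen_macaulay m (dsum M) <->
  (forall i, seq_one_cohen_macaulay m (M i)).
Proof.
move=> nR locR _ fgM.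
have accM i := fin_gen_acc nR (fgM i).
have accS := fin_gen_acc nR (fin_gen_dsum fgM).
have [p [q [qp pq]]] := dsum_biproduct M.
split=> [/(seq_one_cohen_macaulay_layers nR locR accS) cmS i|cmM].
  apply/(seq_one_cohen_macaulay_layers nR locR (accM i)) => s A B hAB.
  have [[A' B'] hAB'] := dim_layer_exists accS (dim_layer_gt hAB).
  exact: dim_layer_summand (pq i) hAB' hAB (cmS _ _ _ hAB').
apply/(seq_one_cohen_macaulay_layers nR locR accS) => s A B hAB.
pose AB i := projT1 (cid (dim_layer_exists (accM i) (dim_layer_gt hAB))).
have hABi i : dim_layer s (AB i).1 (AB i).2.
  exact: projT2 (cid (dim_layer_exists (accM i) (dim_layer_gt hAB))).
apply: (dim_layer_sum qp hAB hABi) => i.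
exact: (seq_one_cohen_macaulay_layers nR locR (accM i)).1 (cmM i) _ _ _ (hABi i).
Qed.
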